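(* Let $H$ be a $K$-bialgebra and $A$ an $H$-module-algebra. Let $\mathcal{C}=\mathrm{CH}^*_{\mathrm{Hopf}}(A,A)=\bigoplus_{n\ge1}\mathrm{CH}^n_{\mathrm{Hopf}}(A,A)$ be equipped with the brace operations $x\{x_1,\dots,x_n\}$ and the multiplication $\pi$ defined in the context, and set $$x\cup y=(-1)^{\deg x}\pi\{x,y\},\qquad d(x)=\pi\{x\}-(-1)^{|x|}x\{\pi\}.$$ Then $(\mathrm{CH}^*_{\mathrm{Hopf}}(A,A),d,\cup)$ is a homotopy $G$-algebra.
   Context: Conventions. $K$ is a fixed field; vector spaces and tensor products are over $K$. $H$ is a $K$-bialgebra (associative, unital, coassociative, counital) with counit $\varepsilon$ and Sweedler notation $\Delta(b)=\sum b_{(1)}\otimes b_{(2)}$, etc. $A$ is an associative unital $K$-algebra with unit $1$. $A$ is an $H$-module-algebra: $A$ is an $H$-module with $b(a_1a_2)=\sum(b_{(1)}a_1)(b_{(2)}a_2)$ and $b(1)=\varepsilon(b)1$ for $b\in H$, $a_1,a_2\in A$. Write $a_{i,j}=a_i\otimes\cdots\otimes a_j$ for elements of $A$, and $x_{i,j}$ for the sequence $x_i,\dots,x_j$. Crossed product algebra. $X=A\otimes A\otimes H$ with the associative unital multiplication $(a_1\otimes a_1'\otimes b^1)(a_2\otimes a_2'\otimes b^2)=\sum a_1(b^1_{(1)}a_2)\otimes(b^1_{(3)}a_2')a_1'\otimes b^1_{(2)}b^2$. $A$ is an $X$-module by $(a\otimes a'\otimes b)a_0=a(ba_0)a'$,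 and $A^{\otimes(n+2)}$ is an $X$-module by $(a\otimes a'\otimes b)(a_0\otimes\cdots\otimes a_{n+1})=\sum a(b_{(1)}a_0)\otimes b_{(2)}a_1\otimes\cdots\otimes b_{(n+1)}a_n\otimes(b_{(n+2)}a_{n+1})a'$. Put $\mathcal{C}(n)=\mathrm{CH}^n_{\mathrm{Hopf}}(A,A)=\mathrm{Hom}_X(A^{\otimes(n+2)},A)$. Structure maps. For $k,n_1,\dots,n_k\ge1$, $f\in\mathcal{C}(k)$, $g_i\in\mathcal{C}(n_i)$, $N_i=n_1+\cdots+n_i$, $N_0=0$, $N=N_k$, define $\gamma(f;g_1,\dots,g_k)\in\mathcal{C}(N)$ by $\gamma(f;g_1,\dots,g_k)(a_{0,N+1})=f(a_0\otimes g_1(1\otimes a_{1,N_1}\otimes1)\otimes\cdots\otimes g_k(1\otimes a_{N_{k-1}+1,N_k}\otimes1)\otimes a_{N+1})$; $\mathrm{Id}\in\mathcal{C}(1)$ is $\mathrm{Id}(a_0\otimes a_1\otimes a_2)=a_0a_1a_2$; $\pi\in\mathcal{C}(2)$ is $\pi(a_0\otimes a_1\otimes a_2\otimes a_3)=a_0a_1a_2a_3$. Brace operations on $\mathcal{C}$. For an element $x$ of degree $n$ put $\deg x=n$, $|x|=n-1$. Define $x\{x_1,\dots,x_n\}=\sum(-1)^{\varepsilon}\gamma(x;\mathrm{Id},\dots,\mathrm{Id},x_1,\mathrm{Id},\dots,\mathrm{Id},x_n,\mathrm{Id},\dots,\mathrm{Id})$, the sum running over all possible substitutions of $x_1,\dots,x_n$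 into $\gamma(x;\dots)$ in the given order, with $\varepsilon=\sum_{p=1}^n|x_p|i_p$, where $i_p$ is the total number of inputs in front of $x_p$. By convention $x\{\}=x$. Brace algebra. A brace algebra is a graded vector space $V=\bigoplus_{n\ge1}V^n$ with operations $x\{x_1,\dots,x_n\}$ of degree $-n$ satisfying $$x\{x_{1,m}\}\{y_{1,n}\}=\sum(-1)^{\varepsilon}x\{y_{1,i_1},x_1\{y_{i_1+1,j_1}\},y_{j_1+1},\dots,y_{i_m},x_m\{y_{i_m+1,j_m}\},y_{j_m+1,n}\},$$ the sum over $0\le i_1\le j_1\le\cdots\le i_m\le j_m\le n$, with $\varepsilon=\sum_{p=1}^m\left(|x_p|\sum_{q=1}^{i_p}|y_q|\right)$. Homotopy $G$-algebra. A homotopy $G$-algebra $(V,d,\cup)$ consists of a brace algebra $V=\bigoplus V^n$, a degree $+1$ differential $d$, and a degree $0$ associative $\cup$-product that make $V$ into a differential graded algebra, such that: (1) for $x_i,y_j\in V$, $(x_1\cup x_2)\{y_{1,n}\}=\sum_{k=0}^n(-1)^{\varepsilon}x_1\{y_{1,k}\}\cup x_2\{y_{k+1,n}\}$ with $\varepsilon=|x_2|\sum_{p=1}^k|y_p|$; (2) $$d(x\{x_{1,n+1}\})-(dx)\{x_{1,n+1}\}-(-1)^{|x|}\sum_{i=1}^{n+1}(-1)^{|x_1|+\cdots+|x_{i-1}|}x\{x_1,\dots,dx_i,\dots,x_{n+1}\}$$ $$=(-1)^{|x||x_1|+1}x_1\cup x\{x_{2,n+1}\}+(-1)^{|x|}\sum_{i=1}^n(-1)^{|x_1|+\cdots+|x_{i-1}|}x\{x_1,\dots,x_i\cup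 x_{i+1},\dots,x_{n+1}\}-x\{x_{1,n}\}\cup x_{n+1}.$$
   Formalization: In identities (1) and (2) of a homotopy G-algebra every product u∪v is replaced by (-1)^{deg u} u∪v; with the printed signs both fail in characteristic other than 2 (e.g. (2) with n=0, x=x_1=Id gives -2π = 2π). The DG-algebra axioms keep ∪ as stated. *)

(* Defs.v *)
From HB Require Import structures.
From mathcomp Require Import all_boot all_order all_algebra.
From mathcomp Require Import boolp classical_sets functions.

Set Implicit Arguments.
Unset Strict Implicit.
Unset Printing Implicit Defensive.

Import GRing.Theory.
Local Open Scope ring_scope.
Local Open Scope quotient_scope.

Notation bilinear f := (bilinear_for *:%R *:%R f).

Section Tensor.
Variables (K : fieldType) (U V : lmodType K).

(* A formal sum [:: (u1, v1); ...; (uk, vk)] stands for the sum of the ui (x) vi;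
   two of them are identified when no K-bilinear map separates them. *)
Definition teval (W : lmodType K) (B : U -> V -> W) (s : seq (U * V)) : W :=
  \sum_(p <- s) B p.1 p.2.

Definition tequiv (s t : seq (U * V)) : bool :=
  `[< forall (W : lmodType K) (B : U -> V -> W),
        bilinear B -> teval B s = teval B t >].

Lemma tequiv_refl : reflexive tequiv.
Proof. by move=> s; apply/asboolP. Qed.

Lemma tequiv_sym : symmetric tequiv.
Proof.
by move=> s t; apply/asboolP/asboolP => st W B bB; rewrite st.
Qed.

Lemma tequiv_trans : transitive tequiv.
Proof.
move=> t s r /asboolP st /asboolP tr; apply/asboolP => W B bB.
by rewrite st // tr.
Qed.

Canonical tequiv_rel := EquivRel tequiv tequiv_refl tequiv_sym tequiv_trans.

Definition tensor := {eq_quot tequiv_rel}.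
HB.instance Definition _ := Choice.on tensor.
HB.instance Definition _ := EqQuotient.on tensor.

Definition tens (u : U) (v : V) : tensor := \pi_tensor [:: (u, v)].

(* The linear map on the tensor product induced by B; it is only meaningful
   when B is bilinear. *)
Definition tlift (W : lmodType K) (B : U -> V -> W) (t : tensor) : W :=
  teval B (repr t).

Lemma tlift_pi (W : lmodType K) (B : U -> V -> W) s :
  bilinear B -> tlift B (\pi_tensor s) = teval B s.
Proof.
move=> bB; rewrite /tlift; have : repr (\pi_tensor s) = s %[mod tensor].
  by rewrite reprK.
by move/eqmodP => /asboolP; apply.
Qed.

Lemma tensor_sep (t t' : tensor) :
  (forall (W : lmodType K) (B : U -> V -> W), bilinear B ->
     tlift B t = tlift B t') -> t = t'.
Proof.
move=> tt'; rewrite -[t]reprK -[t']reprK; apply/eqmodP/asboolP => W B bB.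
exact: tt'.
Qed.

Lemma teval_cat (W : lmodType K) (B : U -> V -> W) s t :
  teval B (s ++ t) = teval B s + teval B t.
Proof. by rewrite /teval big_cat. Qed.

Lemma bilinearZ (W : lmodType K) (B : U -> V -> W) (c : K) u v :
  bilinear B -> B (c *: u) v = c *: B u v.
Proof.
move=> [bl _]; have B0 : B 0 v = 0.
  by have /= := bl v (-1) 0 0; rewrite scaler0 addr0 scaleN1r addNr.
by have /= := bl v c u 0; rewrite !addr0 B0 addr0.
Qed.

Definition tscale_seq (c : K) (s : seq (U * V)) := [seq (c *: p.1, p.2) | p <- s].

Lemma teval_scale (W : lmodType K) (B : U -> V -> W) c s :
  bilinear B -> teval B (tscale_seq c s) = c *: teval B s.
Proof.
move=> bB; rewrite /teval /tscale_seq big_map scaler_sumr.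
by apply: eq_bigr => p _; rewrite /= bilinearZ.
Qed.

Definition tzero : tensor := \pi_tensor [::].
Definition tadd (t t' : tensor) : tensor := \pi_tensor (repr t ++ repr t').
Definition tscale (c : K) (t : tensor) : tensor := \pi_tensor (tscale_seq c (repr t)).
Definition topp := tscale (-1).

Section LiftOps.
Variables (W : lmodType K) (B : U -> V -> W) (bB : bilinear B).

Lemma tlift0 : tlift B tzero = 0.
Proof. by rewrite tlift_pi // /teval big_nil. Qed.

Lemma tliftD_ t t' : tlift B (tadd t t') = tlift B t + tlift B t'.
Proof. by rewrite tlift_pi // teval_cat. Qed.

Lemma tliftZ_ c t : tlift B (tscale c t) = c *: tlift B t.
Proof. by rewrite tlift_pi // teval_scale. Qed.

End LiftOps.

Lemma taddA : associative tadd.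
Proof. by move=> ? ? ?; apply: tensor_sep => W B bB; rewrite !tliftD_ // addrA. Qed.

Lemma taddC : commutative tadd.
Proof. by move=> ? ?; apply: tensor_sep => W B bB; rewrite !tliftD_ // addrC. Qed.

Lemma tadd0 : left_id tzero tadd.
Proof.
by move=> ?; apply: tensor_sep => W B bB; rewrite tliftD_ // tlift0 // add0r.
Qed.

Lemma taddN : left_inverse tzero topp tadd.
Proof.
move=> ?; apply: tensor_sep => W B bB.
by rewrite tliftD_ // tliftZ_ // tlift0 // scaleN1r addNr.
Qed.

HB.instance Definition _ := GRing.isZmodule.Build tensor taddA taddC tadd0 taddN.

Lemma tscaleA a b t : tscale a (tscale b t) = tscale (a * b) t.
Proof. by apply: tensor_sep => W B bB; rewrite !tliftZ_ // scalerA. Qed.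

Lemma tscale1 : left_id 1 tscale.
Proof. by move=> t; apply: tensor_sep => W B bB; rewrite !tliftZ_ // scale1r. Qed.

Lemma tscaleDr : right_distributive tscale +%R.
Proof.
move=> c t t'; apply: tensor_sep => W B bB.
by rewrite tliftZ_ // !tliftD_ // !tliftZ_ // scalerDr.
Qed.

Lemma tscaleDl t : {morph tscale^~ t : a b / a + b}.
Proof.
move=> a b; apply: tensor_sep => W B bB.
by rewrite tliftZ_ // tliftD_ // !tliftZ_ // scalerDl.
Qed.

HB.instance Definition _ := GRing.Zmodule_isLmodule.Build K tensor
  tscaleA tscale1 tscaleDr tscaleDl.

Lemma tlift_linear (W : lmodType K) (B : U -> V -> W) :
  bilinear B -> linear (tlift B).
Proof. by move=> bB c t t'; rewrite tliftD_ // tliftZ_. Qed.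

Lemma tliftE (W : lmodType K) (B : U -> V -> W) u v :
  bilinear B -> tlift B (tens u v) = B u v.
Proof. by move=> bB; rewrite tlift_pi // /teval big_seq1. Qed.

Lemma tens_bilinear : bilinear tens.
Proof.
split=> [v c u u'|u c v v']; apply: tensor_sep => W B bB.
  by rewrite tlift_linear // !tliftE // bB.1.
by rewrite tlift_linear // !tliftE // bB.2.
Qed.

Lemma tensorE (t : tensor) : t = \sum_(p <- repr t) tens p.1 p.2.
Proof.
apply: tensor_sep => W B bB.
rewrite -[in LHS](reprK t) tlift_pi // /teval.
elim: (repr t) => [|p s IH]; first by rewrite !big_nil tlift0.
by rewrite !big_cons tliftD_ // tliftE // IH.
Qed.

End Tensor.

Arguments tens {K U V}.
Arguments tlift {K U V W}.

Definition tmap (K : fieldType) (U V U' V' : lmodType K)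
    (f : U -> U') (g : V -> V') : tensor U V -> tensor U' V' :=
  tlift (fun u v => tens (f u) (g v)).

Definition tassoc (K : fieldType) (U V W : lmodType K) :
    tensor (tensor U V) W -> tensor U (tensor V W) :=
  tlift (fun uv w => tlift (fun u v => tens u (tens v w)) uv).

Definition tmul (K : fieldType) (R S : algType K) (x y : tensor R S) :
    tensor R S :=
  tlift (fun a b => tlift (fun c d => tens (a * c) (b * d)) y) x.

Section TensorTheory.
Variable K : fieldType.
Implicit Types U V W : lmodType K.

Lemma linear_fun_sum U V (f : U -> V) I (r : seq I) (F : I -> U) :
  linear f -> f (\sum_(i <- r) F i) = \sum_(i <- r) f (F i).
Proof.
move=> lf; pose g : {linear U -> V} := HB.pack f (GRing.isLinear.Build K U V _ f lf).
exact: (linear_sum g).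
Qed.

Lemma linear_fun0 U V (f : U -> V) : linear f -> f 0 = 0.
Proof.
by move=> lf; have /= := lf (-1) 0 0; rewrite scaler0 addr0 scaleN1r addNr.
Qed.

Lemma linear_funZ U V (f : U -> V) c u : linear f -> f (c *: u) = c *: f u.
Proof. by move=> lf; have /= := lf c u 0; rewrite !addr0 linear_fun0 // addr0. Qed.

Lemma linear_tlift U V W W' (f : W -> W') (B : U -> V -> W) t :
  linear f -> f (tlift B t) = tlift (fun u v => f (B u v)) t.
Proof. by move=> lf; rewrite /tlift /teval linear_fun_sum. Qed.

Lemma eq_tlift U V W (B B' : U -> V -> W) t :
  (forall u v, B u v = B' u v) -> tlift B t = tlift B' t.
Proof. by move=> BB'; apply: eq_bigr => p _. Qed.

Lemma tlift_linear_arg U V W (X : lmodType K) (B : X -> U -> V -> W) t :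
  (forall u v, linear (fun x => B x u v)) -> linear (fun x => tlift (B x) t).
Proof.
move=> lB c x y; rewrite /tlift /teval scaler_sumr -big_split.
by apply: eq_bigr => p _; rewrite /= lB.
Qed.

Lemma tensor_ext U V W (f g : tensor U V -> W) :
  linear f -> linear g -> (forall u v, f (tens u v) = g (tens u v)) -> f =1 g.
Proof.
move=> lf lg fg t; rewrite (tensorE t) !linear_fun_sum //.
by apply: eq_bigr => p _.
Qed.

Lemma tens_linearl U V (v : V) : linear (tens^~ v : U -> tensor U V).
Proof. by move=> c u u'; rewrite (tens_bilinear _ _).1. Qed.

Lemma tens_linearr U V (u : U) : linear (tens u : V -> tensor U V).
Proof. by move=> c v v'; rewrite (tens_bilinear _ _).2. Qed.

Lemma linear_comp U V W (f : V -> W) (g : U -> V) :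
  linear f -> linear g -> linear (fun x => f (g x)).
Proof. by move=> lf lg c x y; rewrite lg lf. Qed.

Lemma linear_idfun U : linear (fun x : U => x).
Proof. by []. Qed.

Section Tmap.
Variables (U V U' V' : lmodType K) (f : U -> U') (g : V -> V').
Hypotheses (lf : linear f) (lg : linear g).

Lemma tmap_bilinear : bilinear (fun u v => tens (f u) (g v)).
Proof.
split=> [v c x y|u c x y]; first by rewrite lf tens_linearl.
by rewrite lg tens_linearr.
Qed.

Lemma tmap_linear : linear (tmap f g).
Proof. exact: tlift_linear tmap_bilinear. Qed.

Lemma tmapE u v : tmap f g (tens u v) = tens (f u) (g v).
Proof. exact: tliftE tmap_bilinear. Qed.

End Tmap.

Lemma tassoc_bilinear_in U V W (w : W) :
  bilinear (fun (u : U) (v : V) => tens u (tens v w)).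
Proof.
split=> [v c x y|u c x y]; first by rewrite tens_linearl.
by rewrite tens_linearl tens_linearr.
Qed.

Lemma tassoc_bilinear U V W :
  bilinear (fun (uv : tensor U V) (w : W) =>
              tlift (fun u v => tens u (tens v w)) uv).
Proof.
split=> [w|uv]; first exact (tlift_linear (tassoc_bilinear_in U V w)).
apply: tlift_linear_arg => u v; apply: linear_comp; exact: tens_linearr.
Qed.

Lemma tassoc_linear U V W : linear (@tassoc K U V W).
Proof. exact: tlift_linear (tassoc_bilinear _ _ _). Qed.

Lemma tassocE U V W (u : U) (v : V) (w : W) :
  tassoc (tens (tens u v) w) = tens u (tens v w).
Proof.
by rewrite /tassoc tliftE; [rewrite tliftE //; exact: tassoc_bilinear_in
                           |exact: tassoc_bilinear].
Qed.

End TensorTheory.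

Record bialgebra (K : fieldType) (H : algType K) := Bialgebra {
  comul : {linear H -> tensor H H};
  counit : {linear H -> K^o};
  comulA : forall b, tassoc (tmap comul id (comul b)) = tmap id comul (comul b);
  counitl : forall b, tlift (fun b1 b2 => counit b1 *: b2) (comul b) = b;
  counitr : forall b, tlift (fun b1 b2 => counit b2 *: b1) (comul b) = b;
  comul1 : comul 1 = tens 1 1;
  comulM : forall b c, comul (b * c) = tmul (comul b) (comul c);
  counit1 : counit 1 = 1;
  counitM : forall b c, counit (b * c) = counit b * counit c }.

Record module_algebra (K : fieldType) (H : algType K) (D : bialgebra H)
    (A : algType K) := ModuleAlgebra {
  hact : H -> A -> A;
  hact_bilinear : bilinear hact;
  hact1 : forall a, hact 1 a = a;
  hactA : forall b c a, hact (b * c) a = hact b (hact c a);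
  hactM : forall b a1 a2,
    hact b (a1 * a2) = tlift (fun b1 b2 => hact b1 a1 * hact b2 a2) (comul D b);
  hact_unit : forall b, hact b 1 = (counit D b : K) *: 1 }.

Section TensorPowers.
Variables (K : fieldType) (A : lmodType K).

Fixpoint tpow (n : nat) : lmodType K :=
  if n is m.+1 then tensor A (tpow m) else K^o.

(* a 0 (x) ... (x) a n.-1; the other values of a are irrelevant. *)
Fixpoint pure (n : nat) (a : nat -> A) : tpow n :=
  if n is m.+1 return tpow n then tens (a 0%N) (pure m (fun i => a i.+1)) else 1.

Definition acons (a0 : A) (a : nat -> A) (i : nat) : A :=
  if i is j.+1 then a j else a0.

(* The linear map sending pure n a to phi a; it is only meaningful when phi is
   multilinear in its first n arguments and independent of the others. *)
Fixpoint plift (W : lmodType K) (n : nat) (phi : (nat -> A) -> W) : tpow n -> W :=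
  if n is m.+1 return tpow n -> W
  then tlift (fun a0 => plift (fun a => phi (acons a0 a)))
  else fun c => (c : K) *: phi (fun=> 0).

End TensorPowers.

Arguments pure {K A}.

Section TensorPowerTheory.
Variables (K : fieldType) (A : lmodType K).

Lemma pureS n (a : nat -> A) :
  pure n.+1 a = tens (a 0%N) (pure n (fun i => a i.+1)).
Proof. by []. Qed.

Lemma eq_pure n (a a' : nat -> A) :
  (forall i, (i < n)%N -> a i = a' i) -> pure n a = pure n a'.
Proof.
elim: n a a' => [//|n IH] a a' aa' /=.
by rewrite aa' // (IH _ (fun i => a' i.+1)) // => i lin; apply: aa'.
Qed.

Lemma tpow_ext (W : lmodType K) n (f g : tpow A n -> W) :
  linear f -> linear g -> (forall a, f (pure n a) = g (pure n a)) -> f =1 g.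
Proof.
elim: n f g => [|n IH] f g lf lg fg; last first.
  apply: (tensor_ext lf lg) => u; apply: IH.
  - exact: (linear_comp lf (tens_linearr u)).
  - exact: (linear_comp lg (tens_linearr u)).
  by move=> a; apply: (fg (acons u a)).
move=> c; have -> : c = (c : K) *: (1 : K^o) :> K^o by exact: esym (mulr1 _).
by rewrite (linear_funZ _ _ lf) (linear_funZ _ _ lg) (fg (fun=> 0)).
Qed.

Lemma plift_unique (W : lmodType K) n phi (f : tpow A n -> W) :
  linear f -> (forall a, f (pure n a) = phi a) -> plift phi =1 f.
Proof.
elim: n phi f => [|n IH] phi f lf fphi.
  move=> c /=; rewrite -fphi /= -linear_funZ //.
  by congr f; exact: mulr1.
have bf : bilinear (fun u (v : tpow A n) => f (tens u v)).
  split=> [v|u].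
    exact: (linear_comp lf (tens_linearl v)).
  exact: (linear_comp lf (tens_linearr u)).
move=> t; transitivity (tlift (fun u v => f (tens u v)) t).
  apply: eq_tlift => u v.
  apply: (IH _ (fun v => f (tens u v)) (linear_comp lf (tens_linearr u))) => a.
  by rewrite -fphi.
by move: t; apply: (tensor_ext (f := tlift _)) => [||u v]; [exact (tlift_linear bf)|exact lf|exact (tliftE u v bf)].
Qed.

End TensorPowerTheory.

Section Graded.
Variables (K : fieldType) (V : nat -> lmodType K).

(* A graded vector space concentrated in degrees >= 1: V m is the component of
   degree deg = m.+1, so that the index m is the shifted degree |x| = deg x - 1. *)
Definition helt := {m : nat & V m}.
Definition hzero : helt := existT V 0%N 0.
Definition sdeg (x : helt) : nat := tag x.
Definition hdeg (x : helt) : nat := (tag x).+1.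

Record dsum := DSum {
  dcomp : forall m, V m;
  dsum_fin : exists n, forall m, (n <= m)%N -> dcomp m = 0 }.

Lemma dsum_ext (u v : dsum) : (forall m, dcomp u m = dcomp v m) -> u = v.
Proof.
case: u v => [f Pf] [g Pg] /= fg; have e : f = g by apply: functional_extensionality_dep.
by subst g; congr DSum; apply: Prop_irrelevance.
Qed.

HB.instance Definition _ := gen_eqMixin dsum.
HB.instance Definition _ := gen_choiceMixin dsum.

Lemma dzero_fin : exists n, forall m, (n <= m)%N -> (0 : V m) = 0.
Proof. by exists 0%N. Qed.
Definition dzero := DSum dzero_fin.

Lemma dadd_fin (u v : dsum) :
  exists n, forall m, (n <= m)%N -> dcomp u m + dcomp v m = 0.
Proof.
have [[n un] [p vp]] := (dsum_fin u, dsum_fin v); exists (maxn n p) => m.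
by rewrite geq_max => /andP[nm pm]; rewrite un // vp // addr0.
Qed.
Definition dadd u v := DSum (dadd_fin u v).

(* Multiplication of each homogeneous component by a scalar. *)
Lemma dmul_fin (c : nat -> K) (u : dsum) :
  exists n, forall m, (n <= m)%N -> c m *: dcomp u m = 0.
Proof. by have [n un] := dsum_fin u; exists n => m nm; rewrite un // scaler0. Qed.
Definition dmul c u := DSum (dmul_fin c u).

Definition dscale c := dmul (fun=> c).

Fact daddA : associative dadd.
Proof. by move=> u v w; apply: dsum_ext => m; rewrite /= addrA. Qed.
Fact daddC : commutative dadd.
Proof. by move=> u v; apply: dsum_ext => m; rewrite /= addrC. Qed.
Fact dadd0 : left_id dzero dadd.
Proof. by move=> u; apply: dsum_ext => m; rewrite /= add0r. Qed.
Fact daddN : left_inverse dzero (dscale (-1)) dadd.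
Proof. by move=> u; apply: dsum_ext => m; rewrite /= scaleN1r addNr. Qed.

HB.instance Definition _ := GRing.isZmodule.Build dsum daddA daddC dadd0 daddN.

Fact dscaleA a b u : dscale a (dscale b u) = dscale (a * b) u.
Proof. by apply: dsum_ext => m; rewrite /= scalerA. Qed.
Fact dscale1 : left_id 1 dscale.
Proof. by move=> u; apply: dsum_ext => m; rewrite /= scale1r. Qed.
Fact dscaleDr : right_distributive dscale +%R.
Proof. by move=> c u v; apply: dsum_ext => m; rewrite /= scalerDr. Qed.
Fact dscaleDl u : {morph dscale^~ u : a b / a + b}.
Proof. by move=> a b; apply: dsum_ext => m; rewrite /= scalerDl. Qed.

HB.instance Definition _ := GRing.Zmodule_isLmodule.Build K dsum
  dscaleA dscale1 dscaleDr dscaleDl.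

Lemma emb_fin (x : helt) :
  exists n, forall m, (n <= m)%N -> untag (0 : V m) id x = 0.
Proof.
exists (tag x).+1 => m xm; rewrite untag_dflt //.
by apply/eqP => e; rewrite e ltnn in xm.
Qed.
Definition emb (x : helt) : dsum := DSum (emb_fin x).

Definition homog (n : nat) (u : dsum) : Prop :=
  exists2 x : helt, hdeg x = n & u = emb x.

(* psign k maps a homogeneous x to (-1)^(|x| + k) x. *)
Definition psign (k : nat) : dsum -> dsum := dmul (fun m => (-1) ^+ (m + k)).

(* The multilinear extension of an operation B on homogeneous elements. *)
Definition hcomps (u : dsum) : seq helt :=
  [seq Tagged V (dcomp u m) | m <- iota 0 (sval (cid (dsum_fin u)))].

Definition choices (T : Type) : seq (seq T) -> seq (seq T) :=
  foldr (fun s r => [seq x :: l | x <- s, l <- r]) [:: [::]].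

Definition mlextend (B : helt -> seq helt -> dsum) (u : dsum) (us : seq dsum) :
    dsum :=
  \sum_(x <- hcomps u) \sum_(xs <- choices (map hcomps us)) B x xs.

Implicit Types (x y : helt) (xs ys : seq helt) (u v w : dsum) (us : seq dsum).

Definition sdegs xs : nat := (\sum_(x <- xs) sdeg x)%N.

Variable br : dsum -> seq dsum -> dsum.

(* With c = [:: 0; i_1; j_1; ...; i_m; j_m], the arguments
   y_{1,i_1}, x_1{y_{i_1+1,j_1}}, y_{j_1+1}, ..., x_m{y_{i_m+1,j_m}}, y_{j_m+1,n}. *)
Definition insertion xs ys (c : seq nat) : seq dsum :=
  let y a b := [seq emb z | z <- drop a (take b ys)] in
  let arg p := nth 0%N c p in
  flatten [seq rcons (y (arg p.*2) (arg p.*2.+1))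
                     (br (emb (nth hzero xs p))
                         (y (arg p.*2.+1) (arg p.*2.+2)))
          | p <- iota 0 (size xs)]
  ++ y (arg (size xs).*2) (size ys).

Definition insertion_sign xs ys (c : seq nat) : nat :=
  (\sum_(p < size xs)
     sdeg (nth hzero xs p) * sdegs (take (nth 0 c p.*2.+1) ys))%N.

Record is_brace_algebra : Prop := IsBraceAlgebra {
  brace_nil : forall u, br u [::] = u;
  brace_linearl : forall us a u v,
    br (a *: u + v) us = a *: br u us + br v us;
  brace_linearr : forall w us us' a u v,
    br w (us ++ (a *: u + v) :: us') =
    a *: br w (us ++ u :: us') + br w (us ++ v :: us');
  brace_deg : forall x xs,
    homog (hdeg x + \sum_(z <- xs) hdeg z - size xs)%N (br (emb x) (map emb xs));
  brace_brace : forall x xs ys,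
    br (br (emb x) (map emb xs)) (map emb ys) =
    \sum_(t : ((size xs).*2).-tuple 'I_(size ys).+1
            | sorted leq (map val t))
       (-1) ^+ insertion_sign xs ys (0%N :: map val t)
         *: br (emb x) (insertion xs ys (0%N :: map val t)) }.

Variables (d : dsum -> dsum) (cup : dsum -> dsum -> dsum).

Record is_dg_algebra : Prop := IsDGAlgebra {
  diff_linear : linear d;
  diff_deg : forall x, homog (hdeg x).+1 (d (emb x));
  diff_diff : forall u, d (d u) = 0;
  cup_bilinear : bilinear cup;
  cup_deg : forall x y, homog (hdeg x + hdeg y)%N (cup (emb x) (emb y));
  cupA : associative cup;
  diff_cup : forall x v,
    d (cup (emb x) v) = cup (d (emb x)) v + (-1) ^+ hdeg x *: cup (emb x) (d v) }.

(* The product (-1)^(deg u) (u cup v).  The usual signs of the two compatibility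
   identities below are those for this product: with cup itself in its place, both
   identities fail on Hochschild cochains in characteristic other than 2, already
   for cochains of degrees 1 and 2 with H = A = K. *)
Definition scup u v := cup (psign 1 u) v.

Record is_homotopy_G_algebra : Prop := IsHomotopyGAlgebra {
  hG_brace : is_brace_algebra;
  hG_dga : is_dg_algebra;
  hG_cup_brace : forall x1 x2 ys,
    br (scup (emb x1) (emb x2)) (map emb ys) =
    \sum_(k < (size ys).+1)
       (-1) ^+ (sdeg x2 * sdegs (take k ys))
         *: scup (br (emb x1) (map emb (take k ys)))
                 (br (emb x2) (map emb (drop k ys)));
  hG_diff_brace : forall x x1 xs,
    let zs := x1 :: xs in
    let n := size xs in
    let z i := emb (nth x1 zs i) in
    d (br (emb x) (map emb zs)) - br (d (emb x)) (map emb zs)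
    - (-1) ^+ sdeg x *: \sum_(i < n.+1) (-1) ^+ sdegs (take i zs)
        *: br (emb x) (map emb (take i zs) ++ d (z i) :: map emb (drop i.+1 zs))
    = (-1) ^+ (sdeg x * sdeg x1 + 1) *: scup (emb x1) (br (emb x) (map emb xs))
      + (-1) ^+ sdeg x *: \sum_(i < n) (-1) ^+ sdegs (take i zs)
          *: br (emb x) (map emb (take i zs)
                         ++ scup (z i) (z i.+1) :: map emb (drop i.+2 zs))
      - scup (br (emb x) (map emb (take n zs))) (z n) }.

End Graded.

Section HopfCochains.
Variables (K : fieldType) (H : algType K) (D : bialgebra H) (A : algType K).
Variable M : module_algebra D A.

Local Notation "b ** a" := (hact M b a) (at level 40, left associativity).

(* b acts on A^(x)n through its iterated coproduct, b_(1) on the first factor and,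
   by coassociativity, b_(2) on the product of the others; lact and ract multiply
   the first factor on the left and the last one on the right. *)
Fixpoint pact (n : nat) (b : H) : tpow A n -> tpow A n :=
  if n is m.+1 return tpow A n -> tpow A n
  then fun t => tlift (fun b1 b2 => tmap (hact M b1) (@pact m b2) t) (comul D b)
  else fun c => (counit D b : K) *: c.

Definition lact (n : nat) (a : A) : tpow A n -> tpow A n :=
  if n is m.+1 return tpow A n -> tpow A n then tmap ( *%R a) id else id.

Fixpoint ract (n : nat) (a' : A) : tpow A n -> tpow A n :=
  if n is m.+1 return tpow A n -> tpow A n
  then tmap (if m is 0 then *%R^~ a' else id) (@ract m a') else id.

(* The underlying space of the crossed product algebra X.  Its multiplication does
   not occur in the notion of X-linear map, only its two actions do. *)
Definition crossed : lmodType K := tensor A (tensor A H).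

Definition xactA (x : crossed) (a0 : A) : A :=
  tlift (fun a => tlift (fun a' b => a * (b ** a0) * a')) x.

Definition xactT (n : nat) (x : crossed) (t : tpow A n) : tpow A n :=
  tlift (fun a => tlift (fun a' b => lact a (ract a' (pact b t)))) x.

Definition homX (n : nat) : {pred tpow A n.+2 -> A} :=
  fun f => `[< linear f /\ forall x t, f (xactT x t) = xactA x (f t) >].

Lemma hact_linearr b : linear (hact M b).
Proof. exact: (hact_bilinear M).2. Qed.

Lemma hact_linearl a : linear (fun b => hact M b a).
Proof. exact: (hact_bilinear M).1. Qed.

Lemma comul_linear : linear (comul D).
Proof. exact: linearP. Qed.

Lemma mull_linear (a : A) : linear ( *%R a).
Proof. by move=> c x y; rewrite mulrDr scalerAr. Qed.

Lemma mulr_linear (a : A) : linear ( *%R^~ a).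
Proof. by move=> c x y; rewrite mulrDl scalerAl. Qed.

Lemma pact_linear n b : linear (@pact n b).
Proof.
elim: n b => [|n IH] b c x y /=; first by rewrite scalerDr !scalerA mulrC.
apply: (tlift_linear_arg (B := fun x b1 b2 => tmap (hact M b1) (pact b2) x)).
by move=> b1 b2; apply: tmap_linear => //; apply: hact_linearr.
Qed.

Lemma pact_bilinear n : bilinear (@pact n).
Proof.
split=> [t|]; last exact: pact_linear.
elim: n t => [|n IH] t; first by move=> c b b' /=; rewrite linearP scalerDl scalerA.
apply: (linear_comp _ comul_linear); apply: tlift_linear; split.
  move=> b2; apply: (tlift_linear_arg
    (B := fun b1 u v => tens (b1 ** u) (pact b2 v))) => u v.
  exact: (linear_comp (tens_linearl _) (hact_linearl u)).
move=> b1; apply: (tlift_linear_arg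
    (B := fun b2 u v => tens (b1 ** u) (pact b2 v))) => u v.
exact: (linear_comp (tens_linearr _) (IH v)).
Qed.

Lemma pactE n b a (t : tpow A n) :
  pact (n := n.+1) b (tens a t) =
  tlift (fun b1 b2 => tens (b1 ** a) (pact b2 t)) (comul D b).
Proof.
by apply: eq_tlift => b1 b2; rewrite tmapE //; [apply: hact_linearr|apply: pact_linear].
Qed.

Lemma lact_linear n a : linear (@lact n a).
Proof. by case: n => [//|n]; apply: tmap_linear => //; apply: mull_linear. Qed.

Lemma lactE n a a0 (t : tpow A n) : lact (n := n.+1) a (tens a0 t) = tens (a * a0) t.
Proof. by rewrite /lact tmapE //; apply: mull_linear. Qed.

Lemma lact_linearl n (t : tpow A n.+1) : linear (fun a => lact a t).
Proof.
apply: (tlift_linear_arg (B := fun a u v => tens (a * u) v)) => u v.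
exact: (linear_comp (tens_linearl _) (mulr_linear _)).
Qed.

Lemma ract_linear n a : linear (@ract n a).
Proof.
elim: n => [//|n IH]; apply: tmap_linear => //.
by case: n {IH} => // ; apply: mulr_linear.
Qed.

Lemma ractE n a' a (t : tpow A n) :
  (0 < n)%N -> ract (n := n.+1) a' (tens a t) = tens a (ract a' t).
Proof.
by case: n t => [//|n] t _ /=; rewrite tmapE //; apply: (@ract_linear n.+1).
Qed.

Lemma ract1E a' a (c : tpow A 0) : ract (n := 1) a' (tens a c) = tens (a * a') c.
Proof. by rewrite /= tmapE //; apply: mulr_linear. Qed.

Lemma ract_linearl n (t : tpow A n.+1) : linear (fun a => ract a t).
Proof.
elim: n t => [|n IH] t.
  apply: (tlift_linear_arg (B := fun a u v => tens (u * a) v)) => u v.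
  exact: (linear_comp (tens_linearl _) (mull_linear _)).
rewrite -[X in linear X]/(fun a => tlift (fun u (v : tpow A n.+1) => tens u (ract a v)) t).
apply: (tlift_linear_arg (B := fun a u (v : tpow A n.+1) => tens u (ract a v))) => u v.
exact: (linear_comp (tens_linearr _) (IH _)).
Qed.

Lemma xactA_in_bilinear a a0 : bilinear (fun a' b => a * (b ** a0) * a').
Proof.
split=> [b|a']; first exact: mull_linear.
exact: (linear_comp (mulr_linear a') (linear_comp (mull_linear a) (hact_linearl a0))).
Qed.

Lemma xactA_bilinear a0 : bilinear (fun a => tlift (fun a' b => a * (b ** a0) * a')).
Proof.
split=> [x|a]; last exact: (tlift_linear (xactA_in_bilinear a a0)).
apply: (tlift_linear_arg (B := fun a a' b => a * (b ** a0) * a')) => a' b.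
exact: (linear_comp (mulr_linear a') (mulr_linear _)).
Qed.

Lemma xactAE a a' b a0 : xactA (tens a (tens a' b)) a0 = a * (b ** a0) * a'.
Proof.
by rewrite /xactA (tliftE _ _ (xactA_bilinear a0)) (tliftE _ _ (xactA_in_bilinear a a0)).
Qed.

Lemma xactT_in_bilinear n a (t : tpow A n.+1) :
  bilinear (fun a' b => lact a (ract a' (pact b t))).
Proof.
split=> [b|a'].
  exact: (linear_comp (lact_linear a) (ract_linearl (pact b t))).
exact: (linear_comp (lact_linear a)
         (linear_comp (ract_linear a') ((pact_bilinear _).1 t))).
Qed.

Lemma xactT_bilinear n (t : tpow A n.+1) :
  bilinear (fun a => tlift (fun a' b => lact a (ract a' (pact b t)))).
Proof.
split=> [x|a]; last exact: (tlift_linear (xactT_in_bilinear a t)).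
apply: (tlift_linear_arg (B := fun a a' b => lact a (ract a' (pact b t)))) => a' b.
exact: lact_linearl.
Qed.

Lemma xactTE n a a' b (t : tpow A n.+1) :
  xactT (tens a (tens a' b)) t = lact a (ract a' (pact b t)).
Proof.
by rewrite /xactT (tliftE _ _ (xactT_bilinear t)) (tliftE _ _ (xactT_in_bilinear a t)).
Qed.

Lemma xactA_linear x : linear (xactA x).
Proof.
apply: (tlift_linear_arg
  (B := fun a0 a => tlift (fun a' b => a * (b ** a0) * a'))) => a y.
apply: (tlift_linear_arg (B := fun a0 a' b => a * (b ** a0) * a')) => a' b.
exact: (linear_comp (mulr_linear a') (linear_comp (mull_linear a) (hact_linearr b))).
Qed.

(* A linear map is equivariant as soon as it commutes with the actions of the
   three tensor factors. *)
Lemma xact_comm n m (F : tpow A n -> tpow A m) :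
  linear F -> (forall a t, F (lact a t) = lact a (F t)) ->
  (forall a t, F (ract a t) = ract a (F t)) ->
  (forall b t, F (pact b t) = pact b (F t)) ->
  forall x t, F (xactT x t) = xactT x (F t).
Proof.
move=> lF Fl Fr Fp x t; rewrite /xactT linear_tlift //; apply: eq_tlift => a y.
by rewrite linear_tlift //; apply: eq_tlift => a' b; rewrite Fl Fr Fp.
Qed.

Lemma xact_commA n (F : tpow A n -> A) :
  linear F -> (forall a t, F (lact a t) = a * (F t)) ->
  (forall a t, F (ract a t) = F t * a) ->
  (forall b t, F (pact b t) = b ** (F t)) ->
  forall x t, F (xactT x t) = xactA x (F t).
Proof.
move=> lF Fl Fr Fp x t; rewrite /xactT linear_tlift //; apply: eq_tlift => a y.
by rewrite linear_tlift //; apply: eq_tlift => a' b; rewrite Fl Fr Fp mulrA.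
Qed.

Lemma homX_submod n : submod_closed (@homX n).
Proof.
split=> [|c f g].
  apply/asboolP; split=> [c x y|x t]; first by rewrite scaler0 addr0.
  by rewrite (linear_fun0 (xactA_linear x)).
move=> /asboolP[lf fX] /asboolP[lg gX]; apply/asboolP; split.
  move=> d x y; rewrite /= -[LHS]/(c *: f _ + g _) lf lg.
  rewrite -[in RHS]/(d *: (c *: f x + g x) + (c *: f y + g y)).
  by rewrite !scalerDr !scalerA [c * d]mulrC addrACA.
move=> x t; rewrite -[LHS]/(c *: f _ + g _) -[in RHS]/(xactA x (c *: f t + g t)).
by rewrite xactA_linear fX gX.
Qed.

HB.instance Definition _ n :=
  GRing.isSubmodClosed.Build K (tpow A n.+2 -> A) (@homX n) (@homX_submod n).

Record cochain (n : nat) := Cochain {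
  cochain_val : tpow A n.+2 -> A;
  cochain_homX : cochain_val \in @homX n }.

HB.instance Definition _ n := [isSub for @cochain_val n].
HB.instance Definition _ n := [Choice of cochain n by <:].
HB.instance Definition _ n := [SubChoice_isSubLmodule of cochain n by <:].

Lemma cochainP n (f : cochain n) :
  linear (cochain_val f) /\
  forall x t, cochain_val f (xactT x t) = xactA x (cochain_val f t).
Proof. by have /asboolP := cochain_homX f. Qed.

Lemma coassocE (W : lmodType K) (F : H -> H -> H -> W) b :
  (forall x y, linear (F x y)) -> (forall x z, linear (fun y => F x y z)) ->
  (forall y z, linear (fun x => F x y z)) ->
  tlift (fun b1 b2 => tlift (fun b21 b22 => F b1 b21 b22) (comul D b2)) (comul D b) =
  tlift (fun b1 b2 => tlift (fun b11 b12 => F b11 b12 b2) (comul D b1)) (comul D b).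
Proof.
move=> F3 F2 F1.
pose L := tlift (fun x (yz : tensor H H) => tlift (F x) yz).
have bF x : bilinear (F x) by split=> [z|y]; [exact: F2|exact: F3].
have bL : bilinear (fun x (yz : tensor H H) => tlift (F x) yz).
  split=> [yz|x]; last exact: (tlift_linear (bF x)).
  by apply: tlift_linear_arg => y z; apply: F1.
have lL : linear L := tlift_linear bL.
have LE x yz : L (tens x yz) = tlift (F x) yz by exact: tliftE.
have <- : L (tmap id (comul D) (comul D b)) =
    tlift (fun b1 b2 => tlift (fun b21 b22 => F b1 b21 b22) (comul D b2)) (comul D b).
  by rewrite /tmap linear_tlift //; apply: eq_tlift => x y; rewrite LE.
rewrite -(comulA D) /tmap.
rewrite !linear_tlift; [|exact: lL|exact: tassoc_linear].
apply: eq_tlift => x y; rewrite [in LHS](tensorE (comul D x)).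
rewrite (linear_fun_sum _ _ (tens_linearl y)) (linear_fun_sum _ _ (@tassoc_linear _ _ _ _)).
rewrite (linear_fun_sum _ _ lL); apply: eq_bigr => p _.
by rewrite tassocE LE tliftE.
Qed.

Fixpoint tsplit (n m : nat) : tpow A (n + m) -> tensor (tpow A n) (tpow A m) :=
  if n is k.+1 return tpow A (n + m) -> tensor (tpow A n) (tpow A m)
  then tlift (fun a t => tmap (tens a) id (@tsplit k m t))
  else tens (1 : K^o).

Lemma tsplit_in_bilinear n m :
  linear (@tsplit n m) ->
  bilinear (fun a (t : tpow A (n + m)) =>
    tmap (tens a) id (tsplit t) : tensor (tpow A n.+1) (tpow A m)).
Proof.
move=> IH; split=> [t|a].
  apply: (tlift_linear_arg (B := fun (a : A) u v => tens (tens a u) v)) => u v.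
  exact: (linear_comp (tens_linearl _) (tens_linearl _)).
by apply: linear_comp IH; apply: tmap_linear => //; apply: tens_linearr.
Qed.

Lemma tsplit_linear n m : linear (@tsplit n m).
Proof.
elim: n => [|n IH]; first exact: tens_linearr.
exact: (tlift_linear (tsplit_in_bilinear IH)).
Qed.

Lemma tsplitE n m a (t : tpow A (n + m)) :
  tsplit (n := n.+1) (tens a t) =
  tmap (tens a) id (tsplit t) :> tensor (tpow A n.+1) (tpow A m).
Proof. exact: (tliftE _ _ (tsplit_in_bilinear (@tsplit_linear n m))). Qed.

Lemma tsplit_pure n m (a : nat -> A) :
  tsplit (pure (n + m) a) = tens (pure n a) (pure m (fun i => a (n + i)%N)).
Proof.
elim: n a => [//|n IH] a.
by rewrite [pure _ _]/= tsplitE IH tmapE //; apply: tens_linearr.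
Qed.

Definition tact n m b : tensor (tpow A n) (tpow A m) -> tensor (tpow A n) (tpow A m) :=
  fun s => tlift (fun b1 b2 => tmap (@pact n b1) (@pact m b2) s) (comul D b).

Lemma tact_linear n m b : linear (@tact n m b).
Proof.
apply: (tlift_linear_arg (B := fun s b1 b2 => tmap (@pact n b1) (@pact m b2) s)).
by move=> b1 b2; apply: tmap_linear; apply: pact_linear.
Qed.

Lemma tactE n m b (u : tpow A n) (v : tpow A m) :
  tact b (tens u v) = tlift (fun b1 b2 => tens (pact b1 u) (pact b2 v)) (comul D b).
Proof. by apply: eq_tlift => b1 b2; rewrite tmapE //; apply: pact_linear. Qed.

Lemma counitlE (W : lmodType K) (F : H -> W) b : linear F ->
  tlift (fun b1 b2 => (counit D b1 : K) *: F b2) (comul D b) = F b.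
Proof.
move=> lF; rewrite -[in RHS](counitl D b) linear_tlift //.
by apply: eq_tlift => b1 b2; rewrite linear_funZ.
Qed.

Lemma tsplit_pact n m b (t : tpow A (n + m)) :
  tsplit (pact b t) = tact b (tsplit t).
Proof.
elim: n b t => [|n IH] b t.
  rewrite tactE -[in LHS](counitlE b ((@pact_bilinear _).1 t)).
  rewrite linear_tlift; last exact: tens_linearr.
  apply: eq_tlift => b1 b2; rewrite /= (linear_funZ _ _ (tens_linearr _)).
  exact: esym (linear_funZ (counit D b1 : K) (1 : K^o) (tens_linearl (pact b2 t))).
move: t; apply: tensor_ext => [||a t].
- exact: (linear_comp (@tsplit_linear n.+1 m) (@pact_linear (n.+1 + m) b)).
- exact: (linear_comp (@tact_linear n.+1 m b) (@tsplit_linear n.+1 m)).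
rewrite tsplitE (@pactE (n + m)) linear_tlift; last exact: (@tsplit_linear n.+1 m).
transitivity (tlift (fun b1 b2 =>
      tmap (tens (b1 ** a)) id (tact b2 (tsplit t)) : tensor (tpow A n.+1) (tpow A m))
    (comul D b)).
  by apply: eq_tlift => b1 b2; rewrite tsplitE IH.
move: (tsplit t); apply: tensor_ext => [||u v].
- apply: (tlift_linear_arg
    (B := fun s b1 b2 =>
      tmap (tens (b1 ** a)) id (tact b2 s) : tensor (tpow A n.+1) (tpow A m))) => b1 b2.
  apply: (linear_comp _ (@tact_linear _ _ b2)).
  by apply: tmap_linear => //; apply: tens_linearr.
- apply: (linear_comp (@tact_linear n.+1 m b)).
  by apply: tmap_linear => //; apply: tens_linearr.
rewrite tmapE //; last exact: tens_linearr.
rewrite (@tactE n.+1).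
transitivity (tlift (fun b1 b2 => tlift (fun b21 b22 =>
    tens (tens (b1 ** a) (pact b21 u)) (pact b22 v)) (comul D b2)) (comul D b)).
  apply: eq_tlift => b1 b2; rewrite tactE linear_tlift; last first.
    by apply: tmap_linear => //; apply: tens_linearr.
  by apply: eq_tlift => b21 b22; rewrite tmapE //; apply: tens_linearr.
rewrite (coassocE (F := fun x y z => tens (tens (x ** a) (pact y u)) (pact z v))).
- apply: eq_tlift => b1 b2; rewrite pactE.
  exact: esym (linear_tlift _ _ (tens_linearl (pact b2 v))).
- by move=> x y; exact: (linear_comp (tens_linearr _) ((@pact_bilinear _).1 v)).
- move=> x z; apply: (linear_comp (tens_linearl _)).
  exact: (linear_comp (tens_linearr _) ((@pact_bilinear _).1 u)).
- move=> y z; apply: (linear_comp (tens_linearl _)).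
  exact: (linear_comp (tens_linearl _) (hact_linearl a)).
Qed.

Lemma tsplit_ract n m a' (t : tpow A (n + m)) : (0 < m)%N ->
  tsplit (ract a' t) = tmap id (ract a') (tsplit t).
Proof.
move=> m0; elim: n t => [|n IH] t.
  by rewrite /= tmapE //; apply: ract_linear.
have lr := @ract_linear m a'.
move: t; apply: tensor_ext => [||a t].
- exact: (linear_comp (@tsplit_linear n.+1 m) (@ract_linear (n.+1 + m) a')).
- exact: (linear_comp (tmap_linear (@linear_idfun K _) lr) (@tsplit_linear n.+1 m)).
rewrite tsplitE (@ractE (n + m)) ?addn_gt0 ?m0 ?orbT // tsplitE IH.
have lt : linear (tens a : tpow A n -> _) by exact: tens_linearr.
move: (tsplit t); apply: tensor_ext => [||u v].
- by apply: linear_comp; apply: tmap_linear.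
- by apply: linear_comp; apply: tmap_linear.
by rewrite !tmapE.
Qed.

Lemma pure_snoc_lin n : {F : tpow A n -> tpow A n.+1 | linear F /\
  (forall a, F (pure n a) = pure n.+1 (fun i => if (i < n)%N then a i else 1)) /\
  (forall b t, F (pact b t) = pact b (F t))}.
Proof.
elim: n => [|n [F [lF [Fa Fb]]]].
  exists (tens 1); split; [exact: tens_linearr|split=> [a //|b c]].
  rewrite pactE.
  transitivity (tlift (fun b1 b2 => (counit D b1 : K) *:
      (tens 1 ((counit D b2 : K) *: c) : tensor A (tpow A 0))) (comul D b)).
    rewrite (counitlE (F := fun b2 => tens 1 ((counit D b2 : K) *: c))) //.
    apply: (linear_comp (tens_linearr _)) => e x y.
    by rewrite linearP scalerDl scalerA.
  apply: eq_tlift => b1 b2; rewrite hact_unit.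
  by rewrite (linear_funZ _ _ (tens_linearl _)).
have lT : linear (tmap (fun a : A => a) F) by exact: tmap_linear.
exists (tmap (fun a => a) F); split=> //; split=> [a|b t].
  by rewrite [pure n.+1 a]/= tmapE // Fa.
move: t; apply: tensor_ext => [||a t].
- exact: (linear_comp lT (@pact_linear n.+1 b)).
- exact: (linear_comp (@pact_linear n.+2 b) lT).
rewrite pactE tmapE // pactE (linear_tlift _ _ lT).
by apply: eq_tlift => b1 b2; rewrite tmapE // Fb.
Qed.

Lemma pact_tens1 n b (t : tpow A n) :
  pact (n := n.+1) b (tens 1 t) = tens 1 (pact b t).
Proof.
rewrite pactE -(counitlE (F := fun b => tens 1 (pact b t))); last first.
  exact: (linear_comp (tens_linearr _) ((@pact_bilinear _).1 t)).
apply: eq_tlift => b1 b2.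
by rewrite hact_unit (linear_funZ _ _ (tens_linearl _)).
Qed.

Lemma cochain_pact n (f : cochain n) b t :
  cochain_val f (pact b t) = b ** cochain_val f t.
Proof.
have [lf fX] := cochainP f; have := fX (tens 1 (tens 1 b)) t.
rewrite xactTE xactAE mul1r mulr1 => <-; congr cochain_val.
have l1 m (u : tpow A m.+1) : lact 1 u = u.
  move: u; apply: tensor_ext => [||u v].
  - exact: (@lact_linear m.+1 1).
  - exact: linear_idfun.
  by rewrite lactE mul1r.
have r1 m (u : tpow A m) : ract 1 u = u.
  elim: m u => [//|m IH].
  apply: tensor_ext => [||u v].
  - exact: (@ract_linear m.+1 1).
  - exact: linear_idfun.
  case: m IH v => [|m] IH v; first by rewrite ract1E mulr1.
  by rewrite ractE // IH.
by rewrite l1 r1.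
Qed.

Definition CH (m : nat) : lmodType K := cochain m.+1.

(* The number of inputs of g 0, ..., g i.-1. *)
Definition offset (g : nat -> helt CH) (i : nat) : nat := (\sum_(p < i) hdeg (g p))%N.

Definition gamma_slot (g : nat -> helt CH) (a : nat -> A) (i : nat) : A :=
  cochain_val (tagged (g i))
    (pure (hdeg (g i)).+2
       (fun j => if (0 < j <= hdeg (g i))%N then a (offset g i + j)%N else 1)).

(* gamma(f; g 0, ..., g k.-1); the other values of g are irrelevant. *)
Definition gamma_val k (f : cochain k) (g : nat -> helt CH) :
    tpow A (offset g k).+2 -> A :=
  plift (fun a => cochain_val f (pure k.+2 (fun i =>
    if i == 0%N then a 0%N
    else if (i <= k)%N then gamma_slot g a i.-1 else a (offset g k).+1))).

Arguments gamma_val {k} f g t.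

Lemma offsetS g i : offset g i.+1 = (hdeg (g 0%N) + offset (fun p => g p.+1) i)%N.
Proof. by rewrite /offset big_ord_recl. Qed.

Lemma hat_exists (x : helt CH) : exists F : tpow A (hdeg x) -> A, linear F /\
  (forall a, F (pure (hdeg x) a) = cochain_val (tagged x)
    (pure (hdeg x).+2 (fun j => if (0 < j <= hdeg x)%N then a j.-1 else 1))) /\
  (forall b t, F (pact b t) = b ** F t).
Proof.
have [F [lF [Fa Fb]]] := pure_snoc_lin (hdeg x).
have [lf fX] := cochainP (tagged x).
exists (fun t => cochain_val (tagged x) (tens 1 (F t))); split; last split.
- exact: (linear_comp lf (linear_comp (tens_linearr _) lF)).
- move=> a; congr cochain_val; rewrite Fa [RHS]/=; congr (tens _ _).
- by move=> b t; rewrite -(cochain_pact (tagged x)) pact_tens1 Fb.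
Qed.

Lemma blocks_exists k g n : n = (offset g k).+1 ->
  exists F : tpow A n -> tpow A k.+1, linear F /\
  (forall a, F (pure n a) = pure k.+1 (fun i =>
     if (i < k)%N then gamma_slot g (acons 0 a) i else a (offset g k))) /\
  (forall b t, F (pact b t) = pact b (F t)) /\
  (forall a t, F (ract a t) = ract a (F t)).
Proof.
elim: k g n => [|k IH] g n ->.
  rewrite /offset big_ord0; exists id; split; first by [].
  by split=> [a|//]; apply: eq_pure => -[|i].
rewrite offsetS -addnS; set n0 := hdeg _; set m := (offset _ k).+1.
have [F [lF [Fa [Fb Fr]]]] := IH (fun p => g p.+1) m erefl.
have [G [lG [Ga Gb]]] := hat_exists (g 0%N).
have lT : linear (tmap G F) by exact: tmap_linear.
have lS := @tsplit_linear n0 m.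
exists (fun t => tmap G F (tsplit t)); split; first exact: (linear_comp lT lS).
split; [move=> a|split=> [b|a] t].
- rewrite tsplit_pure (tmapE lG lF) Ga Fa [RHS]pureS; congr tens.
    congr cochain_val; apply: eq_pure => -[|j] _ //.
    by rewrite /offset big_ord0.
  apply: (@eq_pure K A k.+1) => i _; rewrite ltnS; case: ltnP => _ //.
  rewrite /gamma_slot; congr cochain_val.
  apply: eq_pure => -[|j] _ //; case: ifP => // _.
  by rewrite offsetS !addnS -addnA.
- rewrite tsplit_pact.
  move: (tsplit t); apply: tensor_ext => [||u v].
  + exact: (linear_comp lT (@tact_linear n0 m b)).
  + exact: (linear_comp (@pact_linear k.+2 b) lT).
  rewrite tactE (tmapE lG lF) (linear_tlift _ _ lT) (@pactE k.+1).
  by apply: eq_tlift => b1 b2; rewrite (tmapE lG lF) Gb Fb.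
rewrite tsplit_ract //.
have lR := @ract_linear m a.
move: (tsplit t); apply: tensor_ext => [||u v].
- exact: (linear_comp lT (tmap_linear (@linear_idfun K _) lR)).
- exact: (linear_comp (@ract_linear k.+2 a) lT).
by rewrite (tmapE (@linear_idfun K _) lR) !(tmapE lG lF) (@ractE k.+1) // Fr.
Qed.

Lemma gamma_val_blocks k (f : cochain k) g :
  exists F : tpow A (offset g k).+2 -> tpow A k.+2, linear F /\
  (forall x t, F (xactT x t) = xactT x (F t)) /\
  (forall t, gamma_val f g t = cochain_val f (F t)) /\
  (forall a, F (pure (offset g k).+2 a) = pure k.+2 (fun i =>
    if i == 0%N then a 0%N
    else if (i <= k)%N then gamma_slot g a i.-1 else a (offset g k).+1)).
Proof.
have [F [lF [Fa [Fb Fr]]]] := blocks_exists (erefl (offset g k).+1).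
have l1 := @linear_idfun K A; have lT := tmap_linear l1 lF.
have [lf fX] := cochainP f.
have Fpure a : tmap (fun x : A => x) F (pure (offset g k).+2 a) = pure k.+2 (fun i =>
    if i == 0%N then a 0%N
    else if (i <= k)%N then gamma_slot g a i.-1 else a (offset g k).+1).
  rewrite (@pureS K A (offset g k).+1) (tmapE l1 lF).
  rewrite Fa [RHS]pureS; congr tens.
  apply: (@eq_pure K A k.+1) => i _ /=; case: ltnP => // _.
  rewrite /gamma_slot; congr cochain_val.
  by apply: eq_pure => -[|j] _ //; case: ifP => // _; rewrite addnS.
exists (tmap (fun x : A => x) F); split=> //; split; last first.
  split=> // t.
  exact: (@plift_unique K A A (offset g k).+2 _ _ (linear_comp lf lT)
           (fun a => congr1 (cochain_val f) (Fpure a)) t).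
apply: xact_comm => // [a|a|b].
- apply: tensor_ext => [||u v].
  + exact: (linear_comp lT (@lact_linear (offset g k).+2 a)).
  + exact: (linear_comp (@lact_linear k.+2 a) lT).
  by rewrite lactE !(tmapE l1 lF) (@lactE k.+1).
- apply: tensor_ext => [||u v].
  + exact: (linear_comp lT (@ract_linear (offset g k).+2 a)).
  + exact: (linear_comp (@ract_linear k.+2 a) lT).
  by rewrite ractE // !(tmapE l1 lF) (@ractE k.+1) // Fr.
apply: tensor_ext => [||u v].
- exact: (linear_comp lT (@pact_linear (offset g k).+2 b)).
- exact: (linear_comp (@pact_linear k.+2 b) lT).
rewrite pactE (tmapE l1 lF) (linear_tlift _ _ lT) (@pactE k.+1).
by apply: eq_tlift => b1 b2; rewrite (tmapE l1 lF) Fb.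
Qed.

Lemma gamma_homX k (f : cochain k) g : gamma_val f g \in @homX (offset g k).
Proof.
have [F [lF [FX [gF _]]]] := gamma_val_blocks f g; have [lf fX] := cochainP f.
apply/asboolP; split=> [c x y|x t]; first by rewrite !gF lF lf.
by rewrite !gF FX fX.
Qed.

Definition gamma k (f : cochain k) g : cochain (offset g k) :=
  Cochain (gamma_homX f g).

Lemma gammaE k (f : cochain k) g a :
  cochain_val (gamma f g) (pure (offset g k).+2 a) =
  cochain_val f (pure k.+2 (fun i =>
    if i == 0%N then a 0%N
    else if (i <= k)%N then gamma_slot g a i.-1 else a (offset g k).+1)).
Proof.
by have [F [_ [_ [gF Fa]]]] := gamma_val_blocks f g; rewrite /= gF Fa.
Qed.

(* pure n a |-> a 0 * ... * a n.-1 *)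
Fixpoint tprod (n : nat) : tpow A n -> A :=
  if n is m.+1 return tpow A n -> A
  then tlift (fun a t => a * @tprod m t) else fun c => (c : K) *: 1.

Lemma tprod_in_bilinear n : linear (@tprod n) ->
  bilinear (fun a (t : tpow A n) => a * tprod t).
Proof.
move=> IH; split=> [t|a]; first exact: mulr_linear.
exact: (linear_comp (mull_linear a) IH).
Qed.

Lemma tprod_linear n : linear (@tprod n).
Proof.
elim: n => [|n IH]; first by move=> c x y; rewrite /= scalerDl scalerA.
exact: (tlift_linear (tprod_in_bilinear IH)).
Qed.

Lemma tprodE n a (t : tpow A n) : tprod (n := n.+1) (tens a t) = a * tprod t.
Proof. exact: (tliftE _ _ (tprod_in_bilinear (@tprod_linear n))). Qed.

Lemma tprod_homX n : @tprod n.+2 \in @homX n.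
Proof.
apply/asboolP; split; first exact: tprod_linear.
apply: xact_commA; first exact: tprod_linear.
- move=> a; apply: tensor_ext => [||u v].
  + exact: (linear_comp (@tprod_linear n.+2) (@lact_linear n.+2 a)).
  + exact: (linear_comp (mull_linear a) (@tprod_linear n.+2)).
  by rewrite lactE !tprodE mulrA.
- move=> a; elim: n.+1 => [|m IH]; apply: tensor_ext => [||u v].
  + exact: (linear_comp (@tprod_linear 1) (@ract_linear 1 a)).
  + exact: (linear_comp (mulr_linear a) (@tprod_linear 1)).
  + by rewrite ract1E !tprodE /= -!scalerAr !mulr1 -scalerAl.
  + exact: (linear_comp (@tprod_linear m.+2) (@ract_linear m.+2 a)).
  + exact: (linear_comp (mulr_linear a) (@tprod_linear m.+2)).
  by rewrite ractE // !tprodE IH mulrA.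
elim: n.+2 => [|m IH] b.
  by move=> c /=; rewrite (linear_funZ _ _ (hact_linearr b)) hact_unit !scalerA mulrC.
apply: tensor_ext => [||u v].
- exact: (linear_comp (@tprod_linear m.+1) (@pact_linear m.+1 b)).
- exact: (linear_comp (hact_linearr b) (@tprod_linear m.+1)).
rewrite pactE tprodE hactM (linear_tlift _ _ (@tprod_linear m.+1)).
by apply: eq_tlift => b1 b2; rewrite tprodE IH.
Qed.

Definition mu (n : nat) : cochain n := Cochain (tprod_homX n).

Lemma muE n (a : nat -> A) :
  cochain_val (mu n) (pure n.+2 a) = \prod_(i < n.+2) a i.
Proof.
rewrite -[LHS]/(tprod (pure n.+2 a)); elim: n.+2 a => [|m IH] a; first by rewrite big_ord0; exact: scale1r.
by rewrite pureS tprodE IH big_ord_recl.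
Qed.

(* Id and pi, of degrees 1 and 2, as homogeneous elements. *)
Definition idc : helt CH := existT CH 0%N (mu 1).
Definition pic : helt CH := existT CH 1%N (mu 2).

(* The slots of x into which the arguments xs are substituted, in order, are the
   ones marked by m; the other ones are filled with Id. *)
Definition fill (m : seq bool) (xs : seq (helt CH)) (i : nat) : helt CH :=
  if nth false m i then nth idc xs (count id (take i m)) else idc.

Definition cochain_emb (n : nat) : cochain n -> dsum CH :=
  if n is m.+1 return cochain n -> dsum CH
  then fun f => emb (existT CH m f) else fun=> 0.

(* In front of slot i there are offset g i inputs. *)
Definition hbrace (x : helt CH) (xs : seq (helt CH)) : dsum CH :=
  \sum_(m : (hdeg x).-tuple bool | count id m == size xs)
     let g := fill m xs in
     (-1) ^+ (\sum_(i < hdeg x | nth false m i) sdeg (g i) * offset g i)%N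
       *: cochain_emb (gamma (tagged x : cochain (hdeg x)) g).

Definition hopf_brace : dsum CH -> seq (dsum CH) -> dsum CH := mlextend hbrace.

Definition hopf_cup (u v : dsum CH) : dsum CH :=
  hopf_brace (emb pic) [:: psign 1 u; v].

Definition hopf_diff (u : dsum CH) : dsum CH :=
  hopf_brace (emb pic) [:: u] - hopf_brace (psign 0 u) [:: emb pic].

End HopfCochains.

Arguments hopf_brace {K H D A} M _ _.
Arguments hopf_cup {K H D A} M _ _.
Arguments hopf_diff {K H D A} M _.

(* Main.v *)
(* An X-linear cochain f of degree n is determined by the multilinear map
   (a_1, ..., a_n) |-> f(1, a_1, ..., a_n, 1), so cochains embed into functions on
   words over A.  There, composition with F of the operator T(Xs) that replaces
   disjoint factors of a word by their values under the Xs, in order and with Koszul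
   signs, is the brace F{Xs}.  T(Xs) is compatible with deconcatenation of words, and
   this yields the brace relation by induction on Xs.

   The rest holds in every brace algebra with an element p of degree 2 such that
   p{p} = 0 and p{x_1, ..., x_n} = 0 for n > 2: each identity of a homotopy G-algebra
   is the expansion of p{p}{...}, x{p}{...}, x{...}{p}, p{x}{...} or p{x, y}{...} by
   the brace relation. *)

Require Import Defs.
From mathcomp Require Import all_boot all_order all_algebra.
From mathcomp Require Import zify boolp.

Set Implicit Arguments.
Unset Strict Implicit.
Unset Printing Implicit Defensive.

Import GRing.Theory.
Local Open Scope ring_scope.

(** * Sums over the factorizations of a word *)

(** The operator T(Xs) takes values in formal combinations of words, but it is never constructed:
    only F o T(Xs) is ([fbr]), and multilinearity of F serves where a combination has to be
    substituted for a single letter. Both [fbr] and [isum] recurse on what remains of a word or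
    list, and the recursive call no longer sees what lies in front. Each step therefore charges all
    later operations at once for the letters or arguments that they pass; unfolded, this gives the
    exponents of the definitions. The embedding into functions comes from the two outer factors: a
    (x) a' (x) 1 in X multiplies the first factor by a on the left and the last one by a' on the
    right, so f(a_0, ..., a_{n+1}) = a_0 f(1, a_1, ..., a_n, 1) a_{n+1}. In the second half, [scup]
    undoes the sign of [cup], so that both compatibility identities concern p{x, y}; the sign comes
    back in associativity and in the Leibniz rule. *)

Section SplitSum.
Variables (T : Type) (V : zmodType).
Implicit Types (f g : seq T -> seq T -> V) (s : seq T).

(** Recursion on the word instead of a sum over cut positions: coassociativity and exchange become
    inductions without arithmetic on indices. *)
Fixpoint splitsum f s : V :=
  f [::] s + (if s is a :: s' then splitsum (fun u v => f (a :: u) v) s' else 0).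

Lemma splitsum_nil f : splitsum f [::] = f [::] [::].
Proof. by rewrite /= addr0. Qed.

Lemma splitsum_cons f a s :
  splitsum f (a :: s) = f [::] (a :: s) + splitsum (fun u v => f (a :: u) v) s.
Proof. by []. Qed.

Lemma eq_splitsum f g s :
  (forall u v, u ++ v = s -> f u v = g u v) -> splitsum f s = splitsum g s.
Proof.
elim: s f g => [|a s IH] f g fg; first by rewrite !splitsum_nil fg.
rewrite !splitsum_cons fg //; congr (_ + _); apply: IH => u v uv.
by rewrite fg //= uv.
Qed.

Lemma splitsum0 s : splitsum (fun _ _ => 0) s = 0.
Proof. by elim: s => [|a s IH]; rewrite /= ?IH addr0. Qed.

Lemma splitsumD f g s :
  splitsum (fun u v => f u v + g u v) s = splitsum f s + splitsum g s.
Proof.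
elim: s f g => [|a s IH] f g; first by rewrite !splitsum_nil.
by rewrite !splitsum_cons IH addrACA.
Qed.

(** Coassociativity of deconcatenation: both sides run over the factorizations of [s] into three
    words. *)
Lemma splitsumA (f : seq T -> seq T -> seq T -> V) s :
  splitsum (fun u v => splitsum (fun u1 u2 => f u1 u2 v) u) s =
  splitsum (fun u v => splitsum (f u) v) s.
Proof.
elim: s f => [|a s IH] f; first by rewrite !splitsum_nil.
rewrite splitsum_cons splitsum_nil [RHS]splitsum_cons splitsum_cons -addrA.
congr (_ + _); rewrite -[in RHS](IH (fun u => f (a :: u))) -splitsumD.
by apply: eq_splitsum => u v _; rewrite splitsum_cons.
Qed.

(** The letter [c] separates the cuts in front of it from those behind it; in a bare concatenation
    the cut at the seam would be counted twice. *)
Lemma splitsum_cat f u c w :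
  splitsum f (u ++ c :: w) =
  splitsum (fun p q => f p (q ++ c :: w)) u
  + splitsum (fun p q => f (u ++ c :: p) q) w.
Proof.
elim: u f => [|a u IH] f; first by rewrite splitsum_nil.
by rewrite cat_cons !splitsum_cons IH addrA.
Qed.

Lemma splitsum_ord f s :
  splitsum f s = \sum_(i < (size s).+1) f (take i s) (drop i s).
Proof.
elim: s f => [|a s IH] f; first by rewrite splitsum_nil big_ord1.
by rewrite splitsum_cons big_ord_recl /= IH.
Qed.

(** Translation into the indexed sums used in the definition of a homotopy G-algebra. *)
Lemma splitsum_nth x0 (f : seq T -> T -> seq T -> V) s :
  splitsum (fun u v => if v is z :: w then f u z w else 0) s =
  \sum_(i < size s) f (take i s) (nth x0 s i) (drop i.+1 s).
Proof.
elim: s f => [|a s IH] f; first by rewrite splitsum_nil big_ord0.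
by rewrite splitsum_cons big_ord_recl /= IH drop0.
Qed.

End SplitSum.

Lemma splitsum_additive (T : Type) (V W : zmodType) (h : V -> W)
    (f : seq T -> seq T -> V) s :
  h 0 = 0 -> {morph h : x y / x + y} ->
  h (splitsum f s) = splitsum (fun u v => h (f u v)) s.
Proof.
move=> h0 hD; elim: s f => [|a s IH] f; first by rewrite !splitsum_nil.
by rewrite !splitsum_cons hD IH.
Qed.

Lemma splitsum_exchange (T S : Type) (V : zmodType)
    (f : seq T -> seq T -> seq S -> seq S -> V) s r :
  splitsum (fun u v => splitsum (f u v) r) s =
  splitsum (fun p q => splitsum (fun u v => f u v p q) s) r.
Proof.
elim: s f => [|a s IH] f.
  by rewrite splitsum_nil; apply: eq_splitsum => u v _; rewrite splitsum_nil.
rewrite splitsum_cons IH -splitsumD.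
by apply: eq_splitsum => u v _; rewrite splitsum_cons.
Qed.

Lemma splitsum_map (T S : Type) (V : zmodType) (h : S -> T)
    (f : seq T -> seq T -> V) s :
  splitsum f (map h s) = splitsum (fun u v => f (map h u) (map h v)) s.
Proof. by elim: s f => [|a s IH] f //=; rewrite IH. Qed.

Section SplitSumLmod.
Variables (K : fieldType) (T : Type) (V : lmodType K).

Lemma splitsumZ c (f : seq T -> seq T -> V) s :
  splitsum (fun u v => c *: f u v) s = c *: splitsum f s.
Proof.
by rewrite (splitsum_additive (h := *:%R c)) ?scaler0 // => x y; rewrite scalerDr.
Qed.

Lemma splitsumP c (f g : seq T -> seq T -> V) s :
  splitsum (fun u v => c *: f u v + g u v) s = c *: splitsum f s + splitsum g s.
Proof. by rewrite splitsumD splitsumZ. Qed.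

End SplitSumLmod.

(** * Signs, and the sum over insertions in the brace relation *)

Lemma sign_parity (R : pzRingType) m n :
  odd m = odd n -> (-1) ^+ m = (-1) ^+ n :> R.
Proof. by rewrite -signr_odd => ->; rewrite signr_odd. Qed.

(** Exponents of signs are compared modulo 2. They are polynomials in degrees and sizes, so trying
    all parities of these decides the equality. *)
Ltac case_odd :=
  rewrite ?(oddD, oddM, oddS) /=;
  repeat match goal with |- context [odd ?n] => case: (odd n) end.

Section Insertions.
Variables (K : fieldType) (T T' : Type) (deg : T -> nat).
Variables (i : T -> T') (op : T -> seq T -> T').

Definition degs (xs : seq T) : nat := (\sum_(x <- xs) deg x)%N.

Lemma degs_nil : degs [::] = 0%N. Proof. exact: big_nil. Qed.
Lemma degs_cons x xs : degs (x :: xs) = (deg x + degs xs)%N.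
Proof. exact: big_cons. Qed.
Lemma degs_cat xs ys : degs (xs ++ ys) = (degs xs + degs ys)%N.
Proof. exact: big_cat. Qed.

(* The sum in the brace relation: F receives the lists of arguments
   y_{1,i_1}, x_1{y_{i_1+1,j_1}}, ..., y_{j_m+1,n}. *)
Fixpoint isum (V : lmodType K) (xs ys : seq T) (F : seq T' -> V) : V :=
  if xs is x :: xs' then
    splitsum (fun y0 y => splitsum (fun y1 y2 =>
      (-1) ^+ (deg x * degs y0 + degs xs' * (degs y0 + degs y1))
        *: isum xs' y2 (fun l => F (map i y0 ++ op x y1 :: l))) y) ys
  else F (map i ys).

Lemma isumP (V : lmodType K) xs ys c (F G : seq T' -> V) :
  isum xs ys (fun l => c *: F l + G l) = c *: isum xs ys F + isum xs ys G.
Proof.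
elim: xs ys F G => [//|x xs IH] ys F G /=; rewrite -splitsumP.
apply: eq_splitsum => y0 y _; rewrite -splitsumP.
by apply: eq_splitsum => y1 y2 _; rewrite IH scalerDr !scalerA mulrC.
Qed.

Lemma isumZ (V : lmodType K) xs ys c (F : seq T' -> V) :
  isum xs ys (fun l => c *: F l) = c *: isum xs ys F.
Proof.
elim: xs ys F => [//|x xs IH] ys F /=; rewrite -splitsumZ.
apply: eq_splitsum => y0 y _; rewrite -splitsumZ.
by apply: eq_splitsum => y1 y2 _; rewrite IH !scalerA mulrC.
Qed.

Lemma eq_isum (V : lmodType K) xs ys (F G : seq T' -> V) :
  F =1 G -> isum xs ys F = isum xs ys G.
Proof.
elim: xs ys F G => [|x xs IH] ys F G FG /=; first exact: FG.
apply: eq_splitsum => y0 y _; apply: eq_splitsum => y1 y2 _.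
by rewrite (IH _ _ _ (fun l => FG _)).
Qed.

Lemma isum_linear (V W : lmodType K) (h : V -> W) xs ys (F : seq T' -> V) :
  linear h -> h (isum xs ys F) = isum xs ys (fun l => h (F l)).
Proof.
move=> lh; have h0 := linear_fun0 lh.
have hD : {morph h : x y / x + y} by move=> x y; have := lh 1 x y; rewrite !scale1r.
elim: xs ys F => [//|x xs IH] ys F /=; rewrite (splitsum_additive _ _ h0 hD).
apply: eq_splitsum => y0 y _; rewrite (splitsum_additive _ _ h0 hD).
by apply: eq_splitsum => y1 y2 _; rewrite (linear_funZ _ _ lh) IH.
Qed.

End Insertions.

(** Naturality. It carries the sum between homogeneous cochains, their images in the direct sum, and
    their functions on words. *)
Lemma isum_map (K : fieldType) (T T' S S' : Type) (degT : T -> nat)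
    (degS : S -> nat) (i : T -> T') (op : T -> seq T -> T') (j : S -> S')
    (pr : S -> seq S -> S') (h : S -> T) (h' : S' -> T') (V : lmodType K) xs ys
    (F : seq T' -> V) :
  (forall x, degT (h x) = degS x) -> (forall x, i (h x) = h' (j x)) ->
  (forall x us, op (h x) (map h us) = h' (pr x us)) ->
  isum degT i op (map h xs) (map h ys) F =
  isum degS j pr xs ys (fun l => F (map h' l)).
Proof.
move=> hdeg hi hop; have hdegs us : degs degT (map h us) = degs degS us.
  by rewrite /degs big_map; apply: eq_bigr.
have hmi us : map i (map h us) = map h' (map j us).
  by rewrite -!map_comp; apply: eq_map => x /=; rewrite hi.
elim: xs ys F => [|x xs IH] ys F /=; first by rewrite hmi.
rewrite splitsum_map; apply: eq_splitsum => y0 y _.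
rewrite splitsum_map; apply: eq_splitsum => y1 y2 _.
rewrite hdeg !hdegs IH; congr (_ *: _); apply: eq_isum => l.
by rewrite map_cat hmi /= hop.
Qed.

(** Braces add shifted degrees, so every list produced by the sum has the same total degree; signs
    in [F] that depend on this total can then be made constant. *)
Lemma eq_isum_degs (K : fieldType) (T T' : Type) (deg : T -> nat) (deg' : T' -> nat)
    (i : T -> T') (op : T -> seq T -> T') (V : lmodType K) xs ys (F G : seq T' -> V) :
  (forall x, deg' (i x) = deg x) ->
  (forall x us, deg' (op x us) = (deg x + degs deg us)%N) ->
  (forall l, degs deg' l = (degs deg xs + degs deg ys)%N -> F l = G l) ->
  isum deg i op xs ys F = isum deg i op xs ys G.
Proof.
move=> degi degop; have degmi us : degs deg' (map i us) = degs deg us.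
  by rewrite /degs big_map; apply: eq_bigr.
elim: xs ys F G => [|x xs IH] ys F G FG /=.
  by apply: FG; rewrite degmi degs_nil.
apply: eq_splitsum => y0 y y0y; apply: eq_splitsum => y1 y2 y12.
congr (_ *: _); apply: IH => l dl; apply: FG.
by rewrite -y0y -y12 !degs_cat !degs_cons dl degmi degop; lia.
Qed.

Lemma isum_splitsum (K : fieldType) (T T' S : Type) (deg : T -> nat)
    (i : T -> T') (op : T -> seq T -> T') (V : lmodType K) xs ys
    (F : seq S -> seq S -> seq T' -> V) s :
  isum deg i op xs ys (fun l => splitsum (fun u v => F u v l) s) =
  splitsum (fun u v => isum deg i op xs ys (F u v)) s.
Proof.
elim: s F => [|a s IH] F.
  by rewrite splitsum_nil; apply: eq_isum => l; rewrite splitsum_nil.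
rewrite splitsum_cons -IH -[isum _ _ _ _ _ (F _ _)]scale1r -isumP.
by apply: eq_isum => l; rewrite splitsum_cons scale1r.
Qed.

(** * Braces on functions of words *)

Section FunctionBrace.
Variables (K : fieldType) (A : lmodType K).

(* (|x|, x): the function x is only ever applied to words of size |x| + 1. *)
Definition opr := (nat * (seq A -> A))%type.
Implicit Types (Xs Ys : seq opr) (s t u v w : seq A).

Let degO Xs := degs (fun X : opr => X.1) Xs.

(** F o T(Xs): the continuation [F] accumulates the output letters. The first operation X reads the
    factor [t] and passes the letters of [u]; the remaining ones pass both [u] and [t], which the
    recursive call on [w] does not see. *)
Fixpoint fbr (V : lmodType K) (F : seq A -> V) Xs s : V :=
  if Xs is X :: Xs' then
    splitsum (fun u v => splitsum (fun t w =>
      if size t == X.1.+1 then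
        (-1) ^+ (size u * X.1 + (size u + size t) * degO Xs')
          *: fbr (fun z => F (u ++ X.2 t :: z)) Xs' w
      else 0) v) s
  else F s.

Definition fop (X : opr) Ys : opr := ((X.1 + degO Ys)%N, fbr X.2 Ys).

(* T(Xs) maps s to a linear combination of words of size size s - degO Xs. *)
Lemma eq_fbr (V : lmodType K) (F G : seq A -> V) Xs s :
  (forall z, (size z + degO Xs)%N = size s -> F z = G z) ->
  fbr F Xs s = fbr G Xs s.
Proof.
elim: Xs F G s => [|X Xs IH] F G s FG /=; first by rewrite FG // /degO degs_nil addn0.
apply: eq_splitsum => u v uv; apply: eq_splitsum => t w tw.
case: eqP => // tX; congr (_ *: _); apply: IH => z zw.
by apply: FG; rewrite -uv -tw !size_cat /= -zw tX /degO degs_cons; lia.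
Qed.

Lemma fbrP (V : lmodType K) c (F G : seq A -> V) Xs s :
  fbr (fun z => c *: F z + G z) Xs s = c *: fbr F Xs s + fbr G Xs s.
Proof.
elim: Xs F G s => [//|X Xs IH] F G s /=; rewrite -splitsumP.
apply: eq_splitsum => u v _; rewrite -splitsumP.
apply: eq_splitsum => t w _; case: eqP => _; last by rewrite scaler0 addr0.
by rewrite IH scalerDr !scalerA mulrC.
Qed.

Lemma fbr_linear (V W : lmodType K) (h : V -> W) (F : seq A -> V) Xs s :
  linear h -> h (fbr F Xs s) = fbr (fun z => h (F z)) Xs s.
Proof.
move=> lh; have h0 := linear_fun0 lh.
have hD : {morph h : x y / x + y} by move=> x y; have := lh 1 x y; rewrite !scale1r.
elim: Xs F s => [//|X Xs IH] F s /=; rewrite (splitsum_additive _ _ h0 hD).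
apply: eq_splitsum => u v _; rewrite (splitsum_additive _ _ h0 hD).
apply: eq_splitsum => t w _; case: eqP => // _.
by rewrite (linear_funZ _ _ lh) IH.
Qed.

Lemma fbrZ (V : lmodType K) c (F : seq A -> V) Xs s :
  fbr (fun z => c *: F z) Xs s = c *: fbr F Xs s.
Proof. by rewrite -fbr_linear // => e x y; rewrite scalerDr !scalerA mulrC. Qed.

Lemma fbr0 (V : lmodType K) Xs s : fbr (fun=> 0 : V) Xs s = 0.
Proof.
by rewrite (eq_fbr (G := fun=> 0 *: 0)) => [|z _]; rewrite ?fbrZ scale0r.
Qed.

Lemma fbrD (V : lmodType K) (F G : seq A -> V) Xs s :
  fbr (fun z => F z + G z) Xs s = fbr F Xs s + fbr G Xs s.
Proof.
rewrite -[fbr F Xs s]scale1r -fbrP.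
by apply: eq_fbr => z _; rewrite scale1r.
Qed.

Lemma fbr_splitsum (V : lmodType K) (T : Type)
    (F : seq T -> seq T -> seq A -> V) r Xs s :
  fbr (fun z => splitsum (fun p q => F p q z) r) Xs s =
  splitsum (fun p q => fbr (F p q) Xs s) r.
Proof.
elim: r F => [|a r IH] F.
  by rewrite splitsum_nil; apply: eq_fbr => z _; rewrite splitsum_nil.
by rewrite splitsum_cons -IH -fbrD; apply: eq_fbr => z _; rewrite splitsum_cons.
Qed.

Lemma fbr_isum (V : lmodType K) (T T' : Type) (deg : T -> nat) (i : T -> T')
    (op : T -> seq T -> T') xs ys (F : seq A -> seq T' -> V) Xs s :
  fbr (fun z => isum deg i op xs ys (F z)) Xs s =
  isum deg i op xs ys (fun l => fbr (F^~ l) Xs s).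
Proof.
elim: xs ys F => [//|x xs IH] ys F /=; rewrite fbr_splitsum.
apply: eq_splitsum => y0 y _; rewrite fbr_splitsum.
by apply: eq_splitsum => y1 y2 _; rewrite fbrZ IH.
Qed.

(* Compatibility of T(Ys) with deconcatenation, where fbr F Ys = F o T(Ys). *)
Lemma fbr_deconcat (V : lmodType K) (F : seq A -> seq A -> V) Ys s :
  fbr (splitsum F) Ys s =
  splitsum (fun Y0 Y1 => splitsum (fun u v =>
    (-1) ^+ (size u * degO Y1) *: fbr (fun p => fbr (F p) Y1 v) Y0 u) s) Ys.
Proof.
elim: Ys F s => [|Y Ys IH] F s.
  rewrite splitsum_nil /=; apply: eq_splitsum => u v _.
  by rewrite /degO degs_nil muln0 expr0 scale1r.
rewrite splitsum_cons /=.
pose e a b := ((-1) ^+ (a * Y.1 + (a + Y.1.+1) * b) : K).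
transitivity (splitsum (fun u v => splitsum (fun t w =>
    (if size t == Y.1.+1 then splitsum (fun p q => e (size u) (degO Ys) *:
         fbr (fun z => F p (q ++ Y.2 t :: z)) Ys w) u else 0) +
    splitsum (fun Y0 Y1 => splitsum (fun p q =>
       if size t == Y.1.+1 then (-1) ^+ (size p * degO Y1) *: (e (size u) (degO Ys) *:
         fbr (fun x => fbr (F (u ++ Y.2 t :: x)) Y1 q) Y0 p) else 0) w) Ys) v) s).
  apply: eq_splitsum => u v _; apply: eq_splitsum => t w _.
  case: eqP => tY; last first.
    by rewrite add0r (eq_splitsum (g := fun _ _ => 0)) ?splitsum0 // => *;
      rewrite splitsum0.
  rewrite tY -/(e _ _) (eq_fbr (G := fun z =>
      splitsum (fun p q => F p (q ++ Y.2 t :: z)) u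
      + splitsum (fun p q => F (u ++ Y.2 t :: p) q) z)); last first.
    by move=> z _; rewrite splitsum_cat.
  rewrite fbrD scalerDr fbr_splitsum splitsumZ IH; congr (_ + _).
  rewrite -splitsumZ; apply: eq_splitsum => Y0 Y1 _.
  rewrite -splitsumZ; apply: eq_splitsum => p q _.
  by rewrite !scalerA mulrC.
under eq_splitsum => u v _ do rewrite splitsumD.
(* A cut of the output in front of the value of Y puts Y into the right half, and then [Y0] is empty
   because Y is the first operation; a cut behind that value puts Y into [Y0]. *)
rewrite splitsumD; congr (_ + _).
  pose G p q t w := if size t == Y.1.+1 then e (size p + size q)%N (degO Ys) *:
    fbr (fun z => F p (q ++ Y.2 t :: z)) Ys w else 0.
  transitivity (splitsum (fun u v =>
      splitsum (fun p q => splitsum (G p q) v) u) s).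
    apply: eq_splitsum => u v _; rewrite (splitsum_exchange G).
    apply: eq_splitsum => t w _; case: eqP => [tY|tY].
      apply: eq_splitsum => p q pq.
      by rewrite /G tY eqxx -pq size_cat.
    rewrite (eq_splitsum (g := fun _ _ => 0)) ?splitsum0 // => p q _.
    by rewrite /G; case: eqP.
  rewrite (splitsumA (fun p q v => splitsum (G p q) v)).
  apply: eq_splitsum => p r _; rewrite -splitsumZ.
  apply: eq_splitsum => q v _; rewrite -splitsumZ.
  apply: eq_splitsum => t w _; rewrite /G; case: eqP => [tY|]; last by rewrite scaler0.
  rewrite scalerA -exprD; congr (_ *: _); apply: sign_parity.
  rewrite tY /degO degs_cons.
  by case_odd.
transitivity (splitsum (fun Y0 Y1 => splitsum (fun u v => splitsum (fun t w =>
    splitsum (fun p q => if size t == Y.1.+1 then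
      (-1) ^+ (size p * degO Y1) *: (e (size u) (degO Ys) *:
         fbr (fun x => fbr (F (u ++ Y.2 t :: x)) Y1 q) Y0 p) else 0) w) v) s) Ys).
  rewrite [RHS]splitsum_exchange; apply: eq_splitsum => u v _.
  by rewrite [RHS]splitsum_exchange.
apply: eq_splitsum => Y0 Y1 Y01.
under eq_splitsum => u v _ do rewrite -splitsumA.
rewrite -splitsumA; apply: eq_splitsum => r q _.
rewrite -splitsumZ; apply: eq_splitsum => u v uv.
rewrite -splitsumZ; apply: eq_splitsum => t p tp.
case: eqP => [tY|]; last by rewrite scaler0.
rewrite !scalerA -!exprD; congr (_ *: _); apply: sign_parity.
rewrite -uv -tp -Y01 !size_cat tY /degO !degs_cat.
by case_odd.
Qed.

(** Once the input [t] of Z is fixed, [Ys] act to its left and [Xs] to its right. This isolates the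
    operation x{y_1} that a brace insertion places behind a first run of y's. *)
Lemma fbr_cat_cons (V : lmodType K) (F : seq A -> V) Ys Z Xs s :
  fbr F (Ys ++ Z :: Xs) s =
  splitsum (fun u v => splitsum (fun t w =>
    if size t == Z.1.+1 then
      (-1) ^+ (size u * (Z.1 + degO Xs) + size t * degO Xs)
        *: fbr (fun p => fbr (fun z => F (p ++ Z.2 t :: z)) Xs w) Ys u
    else 0) v) s.
Proof.
pose sg (u t : seq A) := ((-1) ^+ (size u * (Z.1 + degO Xs) + size t * degO Xs) : K).
elim: Ys F s => [|Y Ys IH] F s.
  apply: eq_splitsum => u v _; apply: eq_splitsum => t w _; case: eqP => // _.
  by congr (_ *: _); apply: sign_parity; rewrite /degO; case_odd.
pose G (u t x t' w : seq A) : V :=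
  if (size t == Y.1.+1) && (size t' == Z.1.+1) then
    (-1) ^+ (size u * Y.1 + (size u + size t) * degO (Ys ++ Z :: Xs)) *: (sg x t' *:
      fbr (fun p => fbr (fun z => F (u ++ Y.2 t :: p ++ Z.2 t' :: z)) Xs w) Ys x)
  else 0.
transitivity (splitsum (fun u v => splitsum (fun t w => splitsum (fun x y =>
    splitsum (G u t x) y) w) v) s).
  rewrite cat_cons /=; apply: eq_splitsum => u v _; apply: eq_splitsum => t w _.
  rewrite IH /G; case: eqP => /= _; last first.
    rewrite (eq_splitsum (g := fun _ _ => 0)) ?splitsum0 // => x y _.
    by rewrite splitsum0.
  rewrite -splitsumZ; apply: eq_splitsum => x y _.
  rewrite -splitsumZ; apply: eq_splitsum => t' w' _.
  by case: eqP => _ //; rewrite scaler0.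
under eq_splitsum => u v _ do rewrite -splitsumA.
rewrite -splitsumA; apply: eq_splitsum => r y _.
transitivity (splitsum (fun t' w => splitsum (fun u v => splitsum (fun t x =>
    G u t x t' w) v) r) y).
  rewrite [RHS]splitsum_exchange; apply: eq_splitsum => u v _.
  by rewrite [RHS]splitsum_exchange.
apply: eq_splitsum => t' w _; rewrite /G; case: eqP => t'Z; last first.
  rewrite (eq_splitsum (g := fun _ _ => 0)) ?splitsum0 // => u v _.
  rewrite (eq_splitsum (g := fun _ _ => 0)) ?splitsum0 // => t x _.
  by rewrite andbF.
rewrite -splitsumZ; apply: eq_splitsum => u v uv.
rewrite -splitsumZ; apply: eq_splitsum => t x tx.
rewrite andbT; case: eqP => tY; last by rewrite scaler0.
rewrite !scalerA -!exprD; congr (_ *: _).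
  apply: sign_parity; rewrite -uv -tx !size_cat t'Z tY /degO degs_cat degs_cons.
  by case_odd.
by apply: eq_fbr => p _; apply: eq_fbr => z _; rewrite -catA.
Qed.

Definition multilinear (V : lmodType K) (F : seq A -> V) :=
  forall u w, linear (fun c => F (u ++ c :: w)).

Lemma multilinear_cons (V : lmodType K) (F : seq A -> V) u a :
  multilinear F -> multilinear (fun z => F (u ++ a :: z)).
Proof. by move=> lF v w c x y; rewrite -!cat_cons !catA lF. Qed.

(** The first operation X reads a factor of the word already transformed by T(Ys). Two
    deconcatenations split the source into u, t, w and Ys into Y0, Y1, Y2: T(Y0) acts on u, X o
    T(Y1) on t is X{Y1}, and T(Y2) on w is left to the induction hypothesis. *)
Lemma fbr_fbr (V : lmodType K) (F : seq A -> V) Xs Ys s : multilinear F ->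
  fbr (fbr F Xs) Ys s =
  isum (fun X : opr => X.1) id fop Xs Ys (fun Zs => fbr F Zs s).
Proof.
elim: Xs F Ys s => [|X Xs IH] F Ys s lF /=; first by rewrite map_id.
set degX := degs _ Xs.
pose g u t w : V := if size t == X.1.+1 then
  (-1) ^+ (size u * X.1 + (size u + size t) * degX) *:
    fbr (fun z => F (u ++ X.2 t :: z)) Xs w
  else 0.
rewrite [LHS](fbr_deconcat (fun u v => splitsum (g u) v)).
apply: eq_splitsum => Y0 Y Y0Y.
transitivity (splitsum (fun u v => splitsum (fun Y1 Y2 => splitsum (fun t w =>
   (-1) ^+ (size u * degO Y + size t * degO Y2) *:
     fbr (fun p => fbr (fun t' => fbr (g p t') Y2 w) Y1 t) Y0 u) v) Y) s).
  apply: eq_splitsum => u v _.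
  under eq_fbr => p _ do rewrite fbr_deconcat.
  rewrite fbr_splitsum -splitsumZ; apply: eq_splitsum => Y1 Y2 _.
  rewrite fbr_splitsum -splitsumZ; apply: eq_splitsum => t w _.
  by rewrite fbrZ scalerA exprD.
rewrite [LHS]splitsum_exchange; apply: eq_splitsum => Y1 Y2 Y12; rewrite map_id.
rewrite (eq_isum_degs (deg' := fun X : opr => X.1) (G := fun l =>
  splitsum (fun u v => splitsum (fun t w => if size t == (fop X Y1).1.+1 then
    (-1) ^+ (size u * ((fop X Y1).1 + degX + degO Y2) + size t * (degX + degO Y2)) *:
      fbr (fun p => fbr (fun z => F (p ++ (fop X Y1).2 t :: z)) l w) Y0 u
    else 0) v) s)) //; last first.
  by move=> l dl; rewrite fbr_cat_cons /degO dl addnA.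
rewrite isum_splitsum -splitsumZ; apply: eq_splitsum => u v _.
rewrite isum_splitsum -splitsumZ; apply: eq_splitsum => t w _.
(* T(Y1) shortens [t] by |Y1|, so X accepts the result exactly when X{Y1} accepts [t]; otherwise
   both sides vanish. *)
rewrite /g; case: eqP => [tX|tX]; last first.
  rewrite (eq_isum _ _ _ _ _ (G := fun l => 0 *: (0 : V))) => [|l];
    last by rewrite scaler0.
  rewrite -isum_linear; last by move=> c x y; rewrite !scale0r scaler0 addr0.
  rewrite scale0r scaler0 (eq_fbr (G := fun=> 0)) ?fbr0 ?scaler0 // => p _.
  rewrite (eq_fbr (G := fun=> 0)) ?fbr0 // => t' t't.
  rewrite (eq_fbr (G := fun=> 0)) ?fbr0 // => w' _.
  by case: eqP => // t'X; case: tX; rewrite -t't t'X.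
(* The remaining sum with the output of X replaced by a variable letter [c]. It is linear in [c], so
   the combination X(T(Y1) t) may be substituted. *)
pose L p c := isum (fun X : opr => X.1) id fop Xs Y2
  (fun l => fbr (fun z => F (p ++ c :: z)) l w).
have lL p : linear (L p).
  move=> c x y; rewrite /L -isumP; apply: eq_isum => l; rewrite -fbrP.
  by apply: eq_fbr => z _; rewrite lF.
(* The sign inside [g], expressed through the source word: sizes drop by |Y0| and |Y1|, and modulo 2
   these differences are sums. *)
pose e : K := (-1) ^+ ((size u + degO Y0) * X.1
                       + (size u + degO Y0 + size t + degO Y1) * degX).
rewrite (eq_fbr (G := fun p => e *: L p ((fop X Y1).2 t))) => [|p pu]; last first.
  rewrite (fbr_linear _ _ _ (lL p)) -fbrZ; apply: eq_fbr => t' t't.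
  rewrite /L -IH; last exact: multilinear_cons.
  rewrite -fbrZ; apply: eq_fbr => w' _.
  have -> : size t' = X.1.+1.
    by apply: (@addIn (degO Y1)); rewrite t't tX.
  rewrite eqxx; congr (_ *: _); apply: sign_parity; rewrite /e -pu tX /=.
  by case_odd.
rewrite isumZ fbrZ !scalerA -!exprD; congr (_ *: _).
  apply: sign_parity; rewrite -Y12 tX /= /degO !degs_cat -/degX.
  by case_odd.
by rewrite /L fbr_isum.
Qed.

End FunctionBrace.

(** * Braces on words as sums over masks of slots *)

Lemma splitsum_take (T : Type) (V : zmodType) k (g : seq T -> seq T -> V) s :
  splitsum (fun t w => if size t == k then g t w else 0) s =
  if (k <= size s)%N then g (take k s) (drop k s) else 0.
Proof.
elim: s k g => [|a s IH] [|k] g; rewrite ?splitsum_nil // splitsum_cons /=.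
  by rewrite splitsum0 addr0.
by rewrite add0r -(IH k (fun t w => g (a :: t) w)).
Qed.

Lemma big_tuple_cons (V : nmodType) (T : finType) n (F : seq T -> V) :
  \sum_(t : n.+1.-tuple T) F t = \sum_(x : T) \sum_(t : n.-tuple T) F (x :: t).
Proof.
rewrite pair_big (reindex (fun p : T * n.-tuple T => [tuple of p.1 :: p.2])) //=.
exists (fun t : n.+1.-tuple T => (thead t, [tuple of behead t])) => [[x t] _|t _].
  by congr (_, _); apply: val_inj.
by apply: val_inj; rewrite /= [in RHS](tuple_eta t).
Qed.

Lemma big_tuple0 (V : nmodType) (T : finType) (F : seq T -> V) :
  \sum_(t : 0.-tuple T) F t = F [::].
Proof.
rewrite (bigD1 [tuple]) //= big1 ?addr0 // => t.
by rewrite tuple0; move/eqP.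
Qed.

Section Masks.
Variables (K : fieldType) (A : lmodType K).
Implicit Types (Xs Ys : seq (opr A)) (s t u v w : seq A).

Let degO Xs := degs (fun X : opr A => X.1) Xs.

Lemma fbr_short (V : lmodType K) (F : seq A -> V) Xs s :
  (size s < degO Xs)%N -> fbr F Xs s = 0.
Proof.
move=> sXs; rewrite (eq_fbr (G := fun=> 0)) ?fbr0 // => z zs.
by move: sXs; rewrite -zs -/(degO Xs) ltnNge leq_addl.
Qed.

(** The first letter is either copied, and then all of [Xs] pass it, or it is the first input of the
    first operation. *)
Lemma fbr_letter (V : lmodType K) (F : seq A -> V) Xs a s :
  fbr F Xs (a :: s) =
  (-1) ^+ degO Xs *: fbr (fun z => F (a :: z)) Xs s +
  if Xs is X :: Xs' then
    if (X.1 <= size s)%N then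
      (-1) ^+ (X.1.+1 * degO Xs') *:
        fbr (fun z => F (X.2 (a :: take X.1 s) :: z)) Xs' (drop X.1 s)
    else 0
  else 0.
Proof.
case: Xs => [|X Xs]; first by rewrite /degO degs_nil expr0 scale1r addr0.
rewrite /= -/(degO _) addrC; congr (_ + _).
  rewrite -splitsumZ; apply: eq_splitsum => u v _.
  rewrite -splitsumZ; apply: eq_splitsum => t w _.
  case: eqP => [tX|]; last by rewrite scaler0.
  rewrite scalerA -exprD; congr (_ *: _); apply: sign_parity.
  by rewrite tX /degO degs_cons; case_odd.
rewrite add0r (splitsum_take X.1 (fun t w => (-1) ^+ (_ + (_ + (size t).+1) * _) *:
   fbr (fun z => F (X.2 (a :: t) :: z)) Xs w)).
by case: leqP => // Xs_; rewrite size_takel.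
Qed.

(** One term of F{Xs}: the mask says of each output letter whether it is a value of an operation or
    a copied input. Masks that do not fit [Xs] or [s] give 0. *)
Fixpoint mask_brace (V : lmodType K) (F : seq A -> V) (m : seq bool) Xs s : V :=
  match m, Xs, s with
  | [::], [::], [::] => F [::]
  | false :: m', _, a :: s' =>
      (-1) ^+ degO Xs *: mask_brace (fun z => F (a :: z)) m' Xs s'
  | true :: m', X :: Xs', _ =>
      if (X.1 < size s)%N then
        (-1) ^+ (X.1.+1 * degO Xs') *:
          mask_brace (fun z => F (X.2 (take X.1.+1 s) :: z)) m' Xs' (drop X.1.+1 s)
      else 0
  | _, _, _ => 0
  end.

Lemma fbr_masks (V : lmodType K) (F : seq A -> V) n Xs s :
  size s = (n + degO Xs)%N ->
  fbr F Xs s = \sum_(m : n.-tuple bool) mask_brace F m Xs s.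
Proof.
elim: n F Xs s => [|n IH] F Xs s.
  rewrite (big_tuple0 (fun m => mask_brace F m Xs s)); case: Xs => [|X Xs] sXs.
    by move: sXs; rewrite /degO degs_nil => /size0nil->.
  have -> : mask_brace F [::] (X :: Xs) s = 0 by [].
  rewrite /=.
  apply: (eq_trans _ (splitsum0 _ _)); apply: eq_splitsum => u v uv.
  apply: (eq_trans _ (splitsum0 _ _)); apply: eq_splitsum => t w tw.
  (* With no output letter there is no room: X consumes |X| + 1 letters, which leaves fewer than the
     later operations need. *)
  case: eqP => // tX; rewrite fbr_short ?scaler0 //.
  by move: sXs; rewrite -uv -tw !size_cat tX /degO degs_cons; lia.
case: s => [//|a s] sXs; rewrite (big_tuple_cons n (fun m => mask_brace F m Xs (a :: s))).
rewrite big_bool /= addrC fbr_letter -scaler_sumr IH; last by case: sXs.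
congr (_ + _); case: Xs sXs => [|X Xs]; first by rewrite big1.
rewrite /degO degs_cons ltnS => sXs; case: leqP => [Xs_|]; last by rewrite big1.
by rewrite -scaler_sumr IH // size_drop /degO; move: sXs => /=; lia.
Qed.

Lemma fbr_op_linear (V : lmodType K) (F : seq A -> V) Xs d c (f g h : seq A -> A) Ys s :
  multilinear F -> (forall t, h t = c *: f t + g t) ->
  fbr F (Xs ++ (d, h) :: Ys) s =
  c *: fbr F (Xs ++ (d, f) :: Ys) s + fbr F (Xs ++ (d, g) :: Ys) s.
Proof.
move=> lF hfg; rewrite !fbr_cat_cons -splitsumP; apply: eq_splitsum => u v _.
rewrite -splitsumP; apply: eq_splitsum => t w _ /=.
case: eqP => _; last by rewrite scaler0 addr0.
rewrite scalerA mulrC -scalerA -scalerDr -fbrP; congr (_ *: _).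
apply: eq_fbr => p _; rewrite -fbrP; apply: eq_fbr => z _.
by rewrite hfg lF.
Qed.

End Masks.

Lemma splitsum_drop (T : Type) (V : zmodType) (f : seq T -> seq T -> V) k s :
  (k <= size s)%N ->
  splitsum f (drop k s) =
  \sum_(i < (size s).+1 | (k <= i)%N) f (drop k (take i s)) (drop i s).
Proof.
elim: s f k => [|a s IH] f [|k] // ks.
- by rewrite splitsum_nil big_ord1_cond.
- by rewrite drop0 splitsum_ord; apply: eq_bigr => i _; rewrite drop0.
by rewrite [drop _ _]/= IH // [RHS]big_mkcond big_ord_recl /= add0r -big_mkcond.
Qed.

(** * Graded vector spaces and multilinear extensions *)

Section GradedTheory.
Variables (K : fieldType) (V : nat -> lmodType K).
Implicit Types (x y : helt V) (xs ys : seq (helt V)) (u v : dsum V) (us : seq (dsum V)).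

Lemma insertion_cons br x xs ys k i j (c : seq nat) :
  insertion br (x :: xs) ys (k :: i :: j :: c) =
  map (@emb _ V) (drop k (take i ys))
  ++ br (emb x) (map (@emb _ V) (drop i (take j ys))) :: insertion br xs ys (j :: c).
Proof.
rewrite /insertion -[iota 0 _]/(0%N :: iota 1 (size xs)) map_cons [flatten _]/=.
rewrite -catA cat_rcons; congr (_ ++ _ :: (_ ++ _)).
by rewrite (iotaDl 1 0) -map_comp; congr flatten; apply: eq_map.
Qed.

Lemma insertion_sign_cons x xs ys k i j (c : seq nat) :
  insertion_sign (x :: xs) ys (k :: i :: j :: c) =
  (sdeg x * degs (@sdeg _ V) (take i ys) + insertion_sign xs ys (j :: c))%N.
Proof. by rewrite /insertion_sign big_ord_recl. Qed.

(** The induction needs an arbitrary starting index: [insertion_sign] counts all of y_1, ...,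
    y_{i_p}, whereas [isum] sees only the arguments behind the first [k]. The factor in front is the
    price of those for all of [xs]. *)
Lemma sum_insertions_from (W : lmodType K) br (F : seq (dsum V) -> W) xs ys k :
  (k <= size ys)%N ->
  \sum_(t : ((size xs).*2).-tuple 'I_(size ys).+1 | path leq k (map val t))
     (-1) ^+ insertion_sign xs ys (k :: map val t)
       *: F (insertion br xs ys (k :: map val t)) =
  (-1) ^+ (degs (@sdeg _ V) xs * degs (@sdeg _ V) (take k ys)) *:
  isum (@sdeg _ V) (@emb _ V) (fun x zs => br (emb x) (map (@emb _ V) zs))
    xs (drop k ys) F.
Proof.
elim: xs F k => [|x xs IH] F k ky; rewrite big_mkcond.
  pose G (t : seq 'I_(size ys).+1) := if path leq k (map val t) then
     (-1) ^+ insertion_sign [::] ys (k :: map val t)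
       *: F (insertion br [::] ys (k :: map val t)) else 0.
  rewrite -[LHS]/(\sum_(t : 0.-tuple _) G t) big_tuple0 /G /=.
  rewrite degs_nil /insertion_sign big_ord0 !expr0 !scale1r /insertion /=.
  by rewrite take_size.
pose G (t : seq 'I_(size ys).+1) := if path leq k (map val t) then
     (-1) ^+ insertion_sign (x :: xs) ys (k :: map val t)
       *: F (insertion br (x :: xs) ys (k :: map val t)) else 0.
rewrite -[LHS]/(\sum_(t : ((size xs).*2).+2.-tuple _) G t) big_tuple_cons.
rewrite [isum _ _ _ _ _ _]/= splitsum_drop // scaler_sumr [RHS]big_mkcond.
apply: eq_bigr => i _; rewrite (big_tuple_cons _ (fun t => G (i :: t))).
rewrite /G /=; case: leqP => ki; last by rewrite big1 // => j _; rewrite big1.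
have iy : (i <= size ys)%N by rewrite -ltnS.
rewrite splitsum_drop // scaler_sumr [RHS]big_mkcond.
apply: eq_bigr => j _; case: leqP => ij; last by rewrite big1.
rewrite -big_mkcond /=.
under eq_bigr => t _ do rewrite insertion_sign_cons insertion_cons exprD -scalerA.
rewrite -scaler_sumr (IH (fun l => F (map (@emb _ V) (drop k (take i ys))
  ++ br (emb x) (map (@emb _ V) (drop i (take j ys))) :: l)) j (ltn_ord j)).
rewrite !scalerA -!exprD; congr (_ *: _).
have yi : degs (@sdeg _ V) (take i ys) = (degs (@sdeg _ V) (take k ys)
    + degs (@sdeg _ V) (drop k (take i ys)))%N.
  by rewrite -degs_cat -{1}(cat_take_drop k (take i ys)) take_takel.
have yj : degs (@sdeg _ V) (take j ys) = (degs (@sdeg _ V) (take i ys)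
    + degs (@sdeg _ V) (drop i (take j ys)))%N.
  by rewrite -degs_cat -{1}(cat_take_drop i (take j ys)) take_takel.
by apply: sign_parity; rewrite yj yi degs_cons; case_odd.
Qed.

Lemma sum_insertions (W : lmodType K) br (F : seq (dsum V) -> W) xs ys :
  \sum_(t : ((size xs).*2).-tuple 'I_(size ys).+1 | sorted leq (map val t))
     (-1) ^+ insertion_sign xs ys (0%N :: map val t)
       *: F (insertion br xs ys (0%N :: map val t)) =
  isum (@sdeg _ V) (@emb _ V) (fun x zs => br (emb x) (map (@emb _ V) zs)) xs ys F.
Proof.
have := sum_insertions_from br F xs (leq0n (size ys)).
rewrite take0 degs_nil muln0 expr0 scale1r drop0 => <-.
by apply: eq_bigl => t; case: (map val t).
Qed.

Lemma dsumE u : exists n, u = \sum_(m < n) emb (Tagged V (dcomp u m)).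
Proof.
have [n un] := dsum_fin u; exists n; apply: dsum_ext => k.
have lk : linear (fun v => dcomp v k) by [].
rewrite (linear_fun_sum _ _ lk) /=; case: (ltnP k n) => kn; last first.
  rewrite un // big1 // => m _; rewrite untag_dflt //=.
  by apply: contraTneq kn => <-; rewrite -ltnNge.
rewrite (bigD1 (Ordinal kn)) //= untagE big1 ?addr0 // => m mk.
by rewrite untag_dflt //=; apply: contra_neq mk => mk; apply: val_inj.
Qed.

Lemma eq_linear_dsum (W : lmodType K) (f g : dsum V -> W) :
  linear f -> linear g -> (forall x, f (emb x) = g (emb x)) -> f =1 g.
Proof.
move=> lf lg fg u; have [n ->] := dsumE u.
by rewrite !linear_fun_sum //; apply: eq_bigr => m _.
Qed.

Section Extension.
Variable W : lmodType K.

Definition tag_linear (f : helt V -> W) :=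
  forall m, linear (fun a : V m => f (Tagged V a)).

(** [hcomps] stops at a bound chosen by [cid]; linearity kills the zero components, so any other
    bound gives the same sum. *)
Lemma sum_hcomps (f : helt V -> W) u n : tag_linear f ->
  (forall m, (n <= m)%N -> dcomp u m = 0) ->
  \sum_(x <- hcomps u) f x = \sum_(m < n) f (Tagged V (dcomp u m)).
Proof.
move=> lf un; pose F m := f (Tagged V (dcomp u m)).
have F0 p q : (forall m, (p <= m)%N -> dcomp u m = 0) -> (p <= q)%N ->
    \sum_(m < q) F m = \sum_(m < p) F m.
  move=> up pq; rewrite -!(big_mkord xpredT F) (big_cat_nat (leq0n p) pq) /=.
  rewrite [X in _ + X]big_nat [X in _ + X]big1 ?addr0 // => m /andP[pm _].
  by rewrite /F up // (linear_fun0 (lf m)).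
rewrite /hcomps; case: cid => p /= up; rewrite big_map.
rewrite -[LHS]/(\sum_(m <- iota 0 p) F m) -[p in iota 0 p]subn0 big_mkord.
by rewrite -(F0 _ _ up (leq_maxl p n)) -(F0 _ _ un (leq_maxr p n)).
Qed.

Lemma sum_hcomps_linear (f : helt V -> W) : tag_linear f ->
  linear (fun u => \sum_(x <- hcomps u) f x).
Proof.
move=> lf c u v; have [[n un] [p vp]] := (dsum_fin u, dsum_fin v).
have un' m : (maxn n p <= m)%N -> dcomp u m = 0.
  by rewrite geq_max => /andP[nm _]; apply: un.
have vp' m : (maxn n p <= m)%N -> dcomp v m = 0.
  by rewrite geq_max => /andP[_ pm]; apply: vp.
rewrite (sum_hcomps lf un') (sum_hcomps lf vp') (@sum_hcomps _ _ (maxn n p)) //.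
  by rewrite scaler_sumr -big_split; apply: eq_bigr => m _; rewrite /= -lf.
by move=> m nm; rewrite /= un' // vp' // scaler0 addr0.
Qed.

Lemma sum_hcomps_emb (f : helt V -> W) x : tag_linear f ->
  \sum_(y <- hcomps (emb x)) f y = f x.
Proof.
move=> lf; case: x => k a.
have ak m : m != k -> dcomp (emb (Tagged V a)) m = 0.
  by move=> mk; rewrite /= untag_dflt //= eq_sym.
rewrite (@sum_hcomps _ _ k.+1) // => [|m km]; last by rewrite ak // gtn_eqF.
rewrite (bigD1 ord_max) //= untagE big1 ?addr0 // => m mk.
rewrite untag_dflt; first exact: (linear_fun0 (lf m)).
by rewrite /= eq_sym; apply: contra_neq mk => mk; apply: val_inj.
Qed.

Definition slot_linear (g : seq (helt V) -> W) :=
  forall xs ys, tag_linear (fun x => g (xs ++ x :: ys)).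

Definition sum_choices (g : seq (helt V) -> W) us :=
  \sum_(xs <- choices (map (@hcomps _ V) us)) g xs.

Lemma sum_choices_cons g u us :
  sum_choices g (u :: us) =
  \sum_(x <- hcomps u) sum_choices (fun l => g (x :: l)) us.
Proof. by rewrite /sum_choices /= big_allpairs_dep. Qed.

Lemma slot_linear_cons g x : slot_linear g -> slot_linear (fun l => g (x :: l)).
Proof. by move=> lg xs ys; apply: (lg (x :: xs)). Qed.

Lemma sum_choices_tag_linear g us : slot_linear g ->
  tag_linear (fun x => sum_choices (fun l => g (x :: l)) us).
Proof.
move=> lg m c a b; rewrite /sum_choices scaler_sumr -big_split.
by apply: eq_bigr => l _; apply: (lg [::]).
Qed.

Lemma sum_choices_emb g xs : slot_linear g ->
  sum_choices g (map (@emb _ V) xs) = g xs.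
Proof.
elim: xs g => [|x xs IH] g lg; first by rewrite /sum_choices /= big_seq1.
rewrite map_cons sum_choices_cons sum_hcomps_emb.
  by rewrite IH //; apply: slot_linear_cons.
exact: sum_choices_tag_linear.
Qed.

Lemma sum_choices_linear g us us' : slot_linear g ->
  linear (fun u => sum_choices g (us ++ u :: us')).
Proof.
elim: us g => [|v us IH] g lg c a b.
  rewrite /= !sum_choices_cons; apply: sum_hcomps_linear.
  exact: sum_choices_tag_linear.
rewrite !cat_cons !sum_choices_cons scaler_sumr -big_split.
by apply: eq_bigr => x _; rewrite IH //; apply: slot_linear_cons.
Qed.

End Extension.

Variable B : helt V -> seq (helt V) -> dsum V.
Hypotheses (Bl : forall xs, tag_linear (B^~ xs)) (Br : forall x, slot_linear (B x)).

Lemma mlextend_emb x xs : mlextend B (emb x) (map (@emb _ V) xs) = B x xs.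
Proof.
rewrite /mlextend (sum_hcomps_emb (f := fun x => sum_choices (B x) _)).
  exact: sum_choices_emb.
move=> m c a b; rewrite /sum_choices scaler_sumr -big_split.
by apply: eq_bigr => l _; apply: Bl.
Qed.

Lemma mlextend_linearl us : linear (fun u => mlextend B u us).
Proof.
apply: (sum_hcomps_linear (f := fun x => sum_choices (B x) us)).
move=> m c a b; rewrite /sum_choices scaler_sumr -big_split.
by apply: eq_bigr => l _; apply: Bl.
Qed.

Lemma mlextend_linearr w us us' : linear (fun u => mlextend B w (us ++ u :: us')).
Proof.
move=> c a b; rewrite /mlextend scaler_sumr -big_split; apply: eq_bigr => x _.
exact: (sum_choices_linear _ _ (Br x)).
Qed.

End GradedTheory.

Section SplitSumEnds.
Variables (T : Type) (V : zmodType).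
Implicit Types (f : seq T -> seq T -> V) (s : seq T).

Lemma splitsum_left f s :
  (forall a u v, f (a :: u) v = 0) -> splitsum f s = f [::] s.
Proof.
move=> f0; case: s => [|a s]; first exact: splitsum_nil.
rewrite splitsum_cons (eq_splitsum (g := fun _ _ => 0)) ?splitsum0 ?addr0 //.
Qed.

Lemma splitsum_right f s :
  (forall a u v, f u (a :: v) = 0) -> splitsum f s = f s [::].
Proof.
elim: s f => [|a s IH] f f0; first exact: splitsum_nil.
by rewrite splitsum_cons f0 add0r IH.
Qed.

Lemma splitsum_rcons f s a :
  splitsum f (rcons s a) = splitsum (fun u v => f u (rcons v a)) s + f (rcons s a) [::].
Proof.
rewrite -cats1 splitsum_cat splitsum_nil.
by under eq_splitsum => u v _ do rewrite cats1.
Qed.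

Lemma splitsum_nth2 x0 (f : seq T -> T -> T -> seq T -> V) a s :
  splitsum (fun u v => if v is x :: y :: w then f u x y w else 0) (a :: s) =
  \sum_(i < size s)
     f (take i (a :: s)) (nth x0 (a :: s) i) (nth x0 s i) (drop i.+1 s).
Proof.
elim: s a f => [|b s IH] a f; first by rewrite splitsum_cons splitsum_nil big_ord0 addr0.
by rewrite splitsum_cons IH big_ord_recl /= drop0.
Qed.

End SplitSumEnds.

Section GradedSigns.
Variables (K : fieldType) (V : nat -> lmodType K).
Implicit Types (x : helt V) (u v : dsum V).

Lemma emb_linear m : linear (fun a : V m => emb (Tagged V a)).
Proof.
move=> c a b; apply: dsum_ext => k /=.
by rewrite /untag; case: eqP => [e|_]; [case: _ / e|rewrite scaler0 addr0].
Qed.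

Lemma homogP n c u v : homog n u -> homog n v -> homog n (c *: u + v).
Proof.
move=> [[m a] /= am ->] [[k b] /= bk ->]; rewrite /hdeg /= in am bk.
have mk : m = k by apply: succn_inj; rewrite am bk.
by subst k; exists (Tagged V (c *: a + b)); rewrite ?emb_linear.
Qed.

Lemma homogZ n c u : homog n u -> homog n (c *: u).
Proof.
move=> hu; have -> : c *: u = (c - 1) *: u + u.
  by rewrite scalerBl scale1r subrK.
exact: homogP.
Qed.

Lemma psign_emb k x : psign k (emb x) = (-1) ^+ (sdeg x + k) *: emb x.
Proof.
apply: dsum_ext => m /=; case: x => n a; rewrite /sdeg /=.
rewrite /untag /=; case: eqP => [e|_]; first by case: _ / e.
by rewrite !scaler0.
Qed.

Lemma psignK k : involutive (@psign K V k).
Proof.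
by move=> u; apply: dsum_ext => m /=; rewrite scalerA -expr2 sqrr_sign scale1r.
Qed.

Lemma psign_linear k : linear (@psign K V k).
Proof. by move=> c u v; apply: dsum_ext => m /=; rewrite scalerDr !scalerA mulrC. Qed.

End GradedSigns.

(** The cancellation in [diff_brace]: [t + w + y] is p{x}{...}, [a] comes from x{...}{p}, and
    [a + b + c] comes from x{p}{...}. *)
Lemma cancel_sum (V : zmodType) (t a b c w y : V) :
  t - a - (t + w + y - (a + b + c)) - b = - w + c - y.
Proof.
rewrite opprB addrA -[a + b + c]addrA [t - a + _]addrA subrK.
rewrite -[t + w + y]addrA [t + (b + c)]addrC addrKA addrAC [b + c]addrC addrK.
by rewrite opprD addrA [- w + c]addrC.
Qed.

(** * Brace algebras with a multiplication *)

Section BraceMultiplication.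
Variables (K : fieldType) (V : nat -> lmodType K).
Variable br : dsum V -> seq (dsum V) -> dsum V.
Hypothesis brA : is_brace_algebra br.
Variable p : helt V.
Hypotheses (p_deg : sdeg p = 1%N) (p_sq : br (emb p) [:: emb p] = 0).
Hypothesis p_arity : forall xs,
  (2 < size xs)%N -> br (emb p) (map (@emb _ V) xs) = 0.
Implicit Types (x y z : helt V) (xs ys zs : seq (helt V)) (u v w : dsum V).

Let e := @emb K V.
Let deg := degs (@sdeg K V).
Let d u := br (e p) [:: u] - br (psign 0 u) [:: e p].
Let cup u v := br (e p) [:: psign 1 u; v].

Lemma br_linearl us : linear (fun u => br u us).
Proof. by move=> c u v; apply: brace_linearl. Qed.

Lemma br_linearr u us us' : linear (fun v => br u (us ++ v :: us')).
Proof. by move=> c v w; apply: brace_linearr. Qed.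

Lemma br_isum x xs ys :
  br (br (e x) (map e xs)) (map e ys) =
  isum (@sdeg _ V) e (fun x zs => br (e x) (map e zs)) xs ys (br (e x)).
Proof. by rewrite (brace_brace brA) (sum_insertions br (br (e x))). Qed.

Lemma br_emb x xs : exists2 z, br (e x) (map e xs) = e z & sdeg z = (sdeg x + deg xs)%N.
Proof.
have [z zn ->] := brace_deg brA x xs; exists z => //; move: zn.
have -> : (\sum_(t <- xs) hdeg t = size xs + deg xs)%N.
  rewrite /deg /degs; under eq_bigr => t _ do rewrite /hdeg -add1n.
  by rewrite big_split sum1_size.
by rewrite /hdeg /sdeg; lia.
Qed.

Lemma br_p_arity us : (2 < size us)%N -> br (e p) us = 0.
Proof.
suff h xs vs : (2 < size xs + size vs)%N -> br (e p) (map e xs ++ vs) = 0.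
  exact: (h [::]).
elim: vs xs => [|v vs IH] xs; first by rewrite cats0 addn0; apply: p_arity.
rewrite /= addnS -addSn => sz; move: v; apply: eq_linear_dsum => [||z].
- exact: br_linearr.
- by move=> c a b; rewrite scaler0 addr0.
by rewrite -cat_rcons -(map_rcons e) IH // size_rcons.
Qed.

Lemma d_emb x : d (e x) = br (e p) [:: e x] - (-1) ^+ sdeg x *: br (e x) [:: e p].
Proof. by rewrite /d psign_emb addn0 (linear_funZ _ _ (br_linearl _)). Qed.

Lemma scupE u v : scup cup u v = br (e p) [:: u; v].
Proof. by rewrite /scup /cup psignK. Qed.

Lemma cup_emb x v : cup (e x) v = (-1) ^+ hdeg x *: br (e p) [:: e x; v].
Proof.
by rewrite /cup psign_emb addn1 (linear_funZ _ _ (br_linearr (e p) [::] [:: v])).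
Qed.

(** p stands alone or is swallowed by one argument. The arguments behind it pass it, and since |p| =
    1 their sign is that of all of [xs] times that of the arguments in front. *)
Lemma isum1 xs (F : seq (dsum V) -> dsum V) :
  isum (@sdeg _ V) e (fun x zs => br (e x) (map e zs)) xs [:: p] F =
  (-1) ^+ deg xs *: splitsum (fun ys zs => (-1) ^+ deg ys *: (
     F (map e ys ++ e p :: map e zs) +
     if zs is z :: zs' then
       (-1) ^+ sdeg z *: F (map e ys ++ br (e z) [:: e p] :: map e zs')
     else 0)) xs.
Proof.
have i0 zs (G : seq (dsum V) -> dsum V) :
    isum (@sdeg _ V) e (fun x zs => br (e x) (map e zs)) zs [::] G = G (map e zs).
  elim: zs G => [//|z zs IH] G; rewrite [LHS]/= !addr0 IH /= degs_nil.
  by rewrite !muln0 expr0 scale1r brace_nil.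
elim: xs F => [|x xs IH] F.
  by rewrite splitsum_nil /deg degs_nil expr0 !scale1r addr0.
rewrite splitsum_cons /= !addr0 !i0 IH /deg !degs_cons !degs_nil -/deg p_deg.
rewrite (brace_nil brA) !scalerDr !scalerA -!exprD -splitsumZ.
rewrite addrC addrA addrAC; congr (_ + _ + _).
- by congr (_ *: _); apply: sign_parity; case_odd.
- by congr (_ *: _); apply: sign_parity; case_odd.
rewrite -splitsumZ; apply: eq_splitsum => ys zs _.
rewrite !scalerA -!exprD; congr (_ *: _); apply: sign_parity.
by rewrite /deg degs_cons; case_odd.
Qed.

Lemma br_br_p x zs :
  br (br (e x) (map e zs)) [:: e p] =
  (-1) ^+ deg zs *: splitsum (fun xs ys => (-1) ^+ deg xs *: (
     br (e x) (map e xs ++ e p :: map e ys) +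
     if ys is z :: ys' then
       (-1) ^+ sdeg z *: br (e x) (map e xs ++ br (e z) [:: e p] :: map e ys')
     else 0)) zs.
Proof. by rewrite -[[:: e p]]/(map e [:: p]) br_isum isum1. Qed.

(** By its arity p takes none, one or two consecutive arguments. *)
Lemma br_p_br x zs :
  br (br (e x) [:: e p]) (map e zs) =
  splitsum (fun xs ys => (-1) ^+ deg xs *: (
     br (e x) (map e xs ++ e p :: map e ys) +
     (if ys is z :: ys' then
       br (e x) (map e xs ++ br (e p) [:: e z] :: map e ys') else 0) +
     (if ys is z :: z' :: ys' then
       br (e x) (map e xs ++ br (e p) [:: e z; e z'] :: map e ys') else 0))) zs.
Proof.
rewrite -[[:: e p]]/(map e [:: p]) br_isum /=; apply: eq_splitsum => xs ys _.
under eq_splitsum => y1 y2 _ do rewrite p_deg mul1n degs_nil mul0n addn0.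
rewrite splitsumZ; congr (_ *: _).
case: ys => [|y [|y' ys]].
- by rewrite splitsum_nil /= !addr0 (brace_nil brA).
- by rewrite splitsum_cons splitsum_nil /= addr0 (brace_nil brA).
rewrite !splitsum_cons /= (brace_nil brA) addrA; congr (_ + _ + _).
case: ys => [|z ys]; rewrite /= ?addr0 //.
rewrite [X in _ + X](eq_splitsum (g := fun _ _ => 0)) => [|us vs _].
  by rewrite splitsum0 addr0.
rewrite br_p_arity // (linear_fun0 (br_linearr (e x) _ _)) //.
Qed.

(** p has room for only one argument besides x{...}: none stays outside, or only the first, or only
    the last. *)
Lemma p_br_br x y zs :
  br (br (e p) [:: e x]) (map e (y :: zs)) =
  br (e p) [:: br (e x) (map e (y :: zs))] +
  (-1) ^+ (sdeg x * sdeg y) *: br (e p) [:: e y; br (e x) (map e zs)] +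
  br (e p) [:: br (e x) (map e (take (size zs) (y :: zs)));
                e (nth y (y :: zs) (size zs))].
Proof.
rewrite -[[:: e x]]/(map e [:: x]) br_isum.
pose f zs0 zs1 zs2 : dsum V := (-1) ^+ (sdeg x * deg zs0) *:
  br (e p) (map e zs0 ++ br (e x) (map e zs1) :: map e zs2).
have f0 zs0 zs1 zs2 : (1 < size zs0 + size zs2)%N -> f zs0 zs1 zs2 = 0.
  move=> sz; rewrite /f br_p_arity ?scaler0 // size_cat /= !size_map.
  by rewrite addnS ltnS.
transitivity (splitsum (fun zs0 => splitsum (f zs0)) (y :: zs)).
  apply: eq_splitsum => zs0 ys _; apply: eq_splitsum => zs1 zs2 _ /=.
  by rewrite degs_nil mul0n addn0.
rewrite splitsum_cons (splitsum_left (f := fun us => splitsum (f (y :: us))))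
  => [|a us vs]; last first.
  rewrite (eq_splitsum (g := fun _ _ => 0)) ?splitsum0 // => zs1 zs2 _.
  by rewrite f0.
rewrite (splitsum_right (f := f [:: y])) => [|a us vs]; last by rewrite f0.
have zsE :
    rcons (take (size zs) (y :: zs)) (nth y (y :: zs) (size zs)) = y :: zs.
  by rewrite -take_nth //; exact: (take_size (y :: zs)).
rewrite -{1}zsE splitsum_rcons zsE splitsum_right => [|a us vs]; last first.
  by rewrite f0 //= size_rcons.
rewrite -addrA addrC; congr (_ + _ + _); rewrite /f /deg ?degs_cons degs_nil ?addn0 //.
- by rewrite muln0 expr0 scale1r.
by rewrite muln0 expr0 scale1r.
Qed.

(** The expansion of p{p}{...} = 0. One argument yields d o d = 0, two the Leibniz rule, three
    associativity. *)
Lemma p_relation zs : splitsum (fun xs ys => (-1) ^+ deg xs *: (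
     br (e p) (map e xs ++ e p :: map e ys) +
     (if ys is z :: ys' then
       br (e p) (map e xs ++ br (e p) [:: e z] :: map e ys') else 0) +
     (if ys is z :: z' :: ys' then
       br (e p) (map e xs ++ br (e p) [:: e z; e z'] :: map e ys') else 0))) zs = 0.
Proof. by rewrite -br_p_br p_sq (linear_fun0 (br_linearl _)). Qed.

Let d_linear : linear d.
Proof.
have l1 := br_linearr (e p) [::] [::]; have l2 := br_linearl [:: e p].
by move=> c u v; rewrite /d psign_linear l1 l2 scalerBr opprD addrACA.
Qed.

Let d_deg x : homog (hdeg x).+1 (d (e x)).
Proof.
have [y e1 y1] := br_emb p [:: x]; have [z e2 z2] := br_emb x [:: p].
rewrite d_emb [br (e p) _]e1 [br (e x) _]e2 addrC -scaleNr; apply: homogP.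
  exists z => //; rewrite /hdeg -/(sdeg z) z2 /deg degs_cons degs_nil p_deg.
  by rewrite /sdeg; lia.
exists y => //; rewrite /hdeg -/(sdeg y) y1 /deg degs_cons degs_nil p_deg.
by rewrite /sdeg; lia.
Qed.

Let dE x xs : d (br (e x) (map e xs)) =
  br (e p) [:: br (e x) (map e xs)]
  - (-1) ^+ (sdeg x + deg xs) *: br (br (e x) (map e xs)) [:: e p].
Proof. by have [z -> zx] := br_emb x xs; rewrite d_emb zx. Qed.

(** In x{p}{p} the two placements of the second p cancel because |p| is odd, and x{p{p}} = 0. The
    terms p{x{p}} cancel as well; what is left is [p_relation] for one argument. *)
Let d_d u : d (d u) = 0.
Proof.
apply: (eq_linear_dsum (linear_comp d_linear d_linear)) => [|x].
  by move=> c a b; rewrite scaler0 addr0.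
have dB v w c : d (v - c *: w) = d v - c *: d w.
  by rewrite addrC -scaleNr d_linear scaleNr addrC.
rewrite d_emb dB (dE p [:: x]) (dE x [:: p]) (br_br_p p [:: x]) /= (br_p_br x [:: p]).
rewrite !splitsum_cons !splitsum_nil /= p_sq.
have := p_relation [:: x]; rewrite !splitsum_cons !splitsum_nil /=.
rewrite /deg !degs_cons !degs_nil p_deg.
rewrite !(addr0, addn0) expr0 !scale1r add1n exprS mulN1r scaleNr opprK scalerA -expr2.
rewrite sqrr_sign scale1r (linear_fun0 (br_linearr (e x) [::] [::])) addr0 expr1.
rewrite scaleN1r subrr scaler0 subr0 => rel.
rewrite -[RHS]rel !addrA addrAC addrK addrAC.
by rewrite addrC addrA.
Qed.

(** An argument outside x1{...} and x2{...} would give p a third one, so only the cuts of [ys] into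
    two parts survive. *)
Let cup_brace x1 x2 ys :
  br (scup cup (e x1) (e x2)) (map e ys) =
  splitsum (fun us vs => (-1) ^+ (sdeg x2 * deg us)
     *: scup cup (br (e x1) (map e us)) (br (e x2) (map e vs))) ys.
Proof.
rewrite scupE -[[:: _; _]]/(map e [:: x1; x2]) br_isum /= splitsum_left => [|a us vs].
  apply: eq_splitsum => us vs _; rewrite /= splitsum_left => [|a ws ts].
    rewrite splitsum_right => [|a ws ts].
      rewrite scupE !degs_nil degs_cons degs_nil !(muln0, add0n, addn0, mul0n).
      by rewrite expr0 scale1r.
    by rewrite br_p_arity ?scaler0.
  apply: (eq_trans _ (splitsum0 _ _)); apply: eq_splitsum => ks ls _.
  by rewrite br_p_arity ?scaler0 //= size_cat /= addnS.
apply: (eq_trans _ (splitsum0 _ _)); apply: eq_splitsum => us' vs' _.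
rewrite -splitsumZ; apply: (eq_trans _ (splitsum0 _ _)); apply: eq_splitsum => ks ls _.
rewrite -splitsumZ; apply: (eq_trans _ (splitsum0 _ _)); apply: eq_splitsum => ts ws _.
by rewrite br_p_arity ?scaler0 //= !size_cat /= !size_cat /= !addnS.
Qed.

(** x{...}{p} and x{p}{...} share the terms in which p stands alone between arguments; z{p} from the
    former and p{z} from the latter combine into dz. *)
Let diff_brace x y zs :
  d (br (e x) (map e (y :: zs))) - br (d (e x)) (map e (y :: zs))
  - (-1) ^+ sdeg x *: splitsum (fun xs ys => if ys is z :: ys' then
      (-1) ^+ deg xs *: br (e x) (map e xs ++ d (e z) :: map e ys') else 0) (y :: zs)
  = (-1) ^+ (sdeg x * sdeg y + 1) *: scup cup (e y) (br (e x) (map e zs))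
    + (-1) ^+ sdeg x *: splitsum (fun xs ys => if ys is z :: z' :: ys' then
        (-1) ^+ deg xs *: br (e x) (map e xs ++ scup cup (e z) (e z') :: map e ys')
        else 0) (y :: zs)
    - scup cup (br (e x) (map e (take (size zs) (y :: zs))))
           (e (nth y (y :: zs) (size zs))).
Proof.
set Z := y :: zs.
pose S1 := splitsum (fun xs ys => (-1) ^+ deg xs *: (
     br (e x) (map e xs ++ e p :: map e ys) +
     if ys is z :: ys' then
       (-1) ^+ sdeg z *: br (e x) (map e xs ++ br (e z) [:: e p] :: map e ys')
     else 0)) Z.
set S3 := splitsum _ _; set S4 := splitsum _ _.
have S2 : br (br (e x) [:: e p]) (map e Z) = S1 + S3 + S4.
  rewrite br_p_br -!splitsumD; apply: eq_splitsum => us vs _.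
  rewrite -addrA scalerDr [in RHS]scalerDr -!addrA; congr (_ + _).
  case: vs => [|v vs]; first by rewrite !addr0 scaler0.
  rewrite scalerDr addrA; congr (_ + _); last first.
    by case: vs => [|v' vs]; rewrite ?scaler0 // scupE.
  have -> : d (e v) = - (-1) ^+ sdeg v *: br (e v) [:: e p] + br (e p) [:: e v].
    by rewrite d_emb addrC scaleNr.
  rewrite -scalerDr br_linearr; congr (_ *: _).
  by rewrite scaleNr addNKr.
rewrite dE br_br_p -/S1 scalerA exprD -mulrA -expr2 sqrr_sign mulr1 d_emb.
have brB u v c us : br (u - c *: v) us = br u us - c *: br v us.
  by rewrite addrC -scaleNr br_linearl scaleNr addrC.
by rewrite brB p_br_br S2 !scalerDr cancel_sum !scupE exprD expr1 mulrN1 scaleNr.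
Qed.

Let cup_linearl v : linear (cup^~ v).
Proof. by move=> c a b; rewrite /cup psign_linear (br_linearr (e p) [::] [:: v]). Qed.

Let cup_linearr u : linear (cup u).
Proof. by move=> c a b; rewrite /cup (br_linearr (e p) [:: _] [::]). Qed.

Let cup_deg x y : homog (hdeg x + hdeg y)%N (cup (e x) (e y)).
Proof.
have [z ez dz] := br_emb p [:: x; y]; rewrite cup_emb [br (e p) _]ez.
apply: homogZ; exists z => //; move: dz; rewrite /deg !degs_cons degs_nil p_deg.
by rewrite /sdeg /hdeg; lia.
Qed.

Let scup_assoc x y z :
  br (e p) [:: br (e p) [:: e x; e y]; e z] =
  (-1) ^+ hdeg x *: br (e p) [:: e x; br (e p) [:: e y; e z]].
Proof.
have := p_relation [:: x; y; z]; rewrite !splitsum_cons !splitsum_nil /=.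
rewrite ![br (e p) [:: _, _, _ & _]]br_p_arity // !(addr0, add0r, scaler0).
rewrite /deg !degs_cons !degs_nil addn0 expr0 scale1r => /eqP.
by rewrite addr_eq0 -scaleNr -mulN1r -exprS => /eqP.
Qed.

(** The factor (-1)^(deg x) in [cup] is what absorbs the sign of [scup_assoc]. *)
Let cup_assoc : associative cup.
Proof.
have lA u v : linear (fun w => cup u (cup v w)).
  exact: (linear_comp (cup_linearr u) (cup_linearr v)).
have lB u w : linear (fun v => cup u (cup v w)).
  exact: (linear_comp (cup_linearr u) (cup_linearl w)).
have lC v w : linear (fun u => cup (cup u v) w).
  exact: (linear_comp (cup_linearl w) (cup_linearl v)).
have lD u w : linear (fun v => cup (cup u v) w).
  exact: (linear_comp (cup_linearl w) (cup_linearr u)).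
move=> u v w; move: w; apply: eq_linear_dsum; [exact: lA|exact: cup_linearr|].
move=> z; move: v; apply: eq_linear_dsum; [exact: lB|exact: lD|move=> y].
move: u; apply: eq_linear_dsum; [exact: cup_linearl|exact: lC|move=> x].
rewrite (cup_emb y) (linear_funZ _ _ (cup_linearr _)) !cup_emb.
rewrite (linear_funZ _ _ (cup_linearl _)).
have [t et dt] := br_emb p [:: x; y]; rewrite [br (e p) [:: e x; e y]]et cup_emb -et.
rewrite scup_assoc !scalerA -!exprD; congr (_ *: _); apply: sign_parity.
rewrite /hdeg -!/(sdeg _) dt /deg !degs_cons degs_nil p_deg.
by case_odd.
Qed.

(** [diff_brace] applied to p itself, where dp = 0 because p{p} = 0; its right-hand side vanishes by
    [p_relation] for two arguments. *)
Let d_cup x v : d (cup (e x) v) = cup (d (e x)) v + (-1) ^+ hdeg x *: cup (e x) (d v).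
Proof.
move: v; apply: eq_linear_dsum => [||y].
- exact: (linear_comp d_linear (cup_linearr _)).
- move=> c a b; rewrite cup_linearr d_linear cup_linearr.
  by rewrite !scalerDr !scalerA [c * _]mulrC addrACA.
have dp : d (e p) = 0.
  by rewrite d_emb p_sq scaler0 subr0.
have := diff_brace p x [:: y]; rewrite !splitsum_cons !splitsum_nil /= dp.
rewrite (linear_fun0 (br_linearl _)) !scupE p_deg mul1n /deg degs_cons degs_nil addn0.
rewrite !(expr0, expr1, scale1r, addr0, subr0) scaleN1r opprK => dxy.
have := p_relation [:: x; y]; rewrite !splitsum_cons !splitsum_nil /=.
rewrite ![br (e p) [:: _, _, _ & _]]br_p_arity // !(addr0, add0r, scaler0).
rewrite /deg degs_cons degs_nil addn0 expr0 scale1r => rel.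
have {rel}dxy : d (br (e p) [:: e x; e y]) =
    - (br (e p) [:: d (e x); e y] + (-1) ^+ sdeg x *: br (e p) [:: e x; d (e y)]).
  apply/eqP; rewrite -addr_eq0 dxy exprD expr1 mulrN1 !scaleNr scale1r.
  by rewrite -!opprD oppr_eq0 addrC [(_ *: _) + _]addrC addrA rel.
rewrite !cup_emb (linear_funZ _ _ d_linear) dxy.
have [w wx ->] := d_deg x; rewrite cup_emb wx /hdeg -/(sdeg x).
rewrite !exprS !mulN1r opprK !scaleNr scalerN opprK scalerDr !scalerA -expr2 sqrr_sign.
by rewrite mulrN1 mulNr scaleNr opprK -expr2 sqrr_sign.
Qed.

Lemma brace_multiplication_homotopy_G : is_homotopy_G_algebra br d cup.
Proof.
split=> //.
- by move=> x1 x2 ys; rewrite [LHS]cup_brace splitsum_ord.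
move=> x x1 xs zs n z; have := diff_brace x x1 xs.
rewrite (splitsum_nth x1 (fun us z vs => (-1) ^+ deg us *:
  br (e x) (map e us ++ d (e z) :: map e vs))).
by rewrite (splitsum_nth2 x1 (fun us z z' vs => (-1) ^+ deg us *:
  br (e x) (map e us ++ scup cup (e z) (e z') :: map e vs))).
Qed.

End BraceMultiplication.

Lemma pure_linear (K : fieldType) (A : lmodType K) n (a b d : nat -> A) c k :
  (k < n)%N -> d k = c *: a k + b k ->
  (forall j, j != k -> d j = a j) -> (forall j, j != k -> d j = b j) ->
  pure n d = c *: pure n a + pure n b.
Proof.
elim: n k a b d => [//|n IH] [|k] a b d kn dk da db; rewrite !pureS.
  rewrite dk tens_linearl; congr (_ *: tens _ _ + tens _ _).
    by apply: eq_pure => j _; apply: da.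
  by apply: eq_pure => j _; apply: db.
rewrite (IH k (fun j => a j.+1) (fun j => b j.+1)) //.
- by rewrite tens_linearr -da // -db.
- by move=> j jk; apply: da.
by move=> j jk; apply: db.
Qed.

Lemma lact_pure (K : fieldType) (A : algType K) n a (w : nat -> A) :
  lact a (pure n.+1 w) = pure n.+1 (fun i => if i is 0 then a * w 0%N else w i).
Proof. by rewrite [pure _ w]pureS lactE. Qed.

Lemma ract_pure (K : fieldType) (A : algType K) n a (w : nat -> A) :
  ract a (pure n.+1 w) = pure n.+1 (fun i => if i == n then w i * a else w i).
Proof.
elim: n w => [|n IH] w; first by rewrite pureS ract1E.
by rewrite pureS ractE // IH [RHS]pureS.
Qed.

(** * Hopf-Hochschild cochains as functions of words *)

Section CochainWords.
Variables (K : fieldType) (H : algType K) (D : bialgebra H) (A : algType K).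
Variable M : module_algebra D A.
Local Notation C := (CH M).
Implicit Types (x : helt C) (xs : seq (helt C)) (s : seq A).

(* nth 1 (1 :: s) is the sequence 1, s_1, ..., s_n, 1. *)
Definition wval n (f : cochain M n) (s : seq A) : A :=
  cochain_val f (pure n.+2 (nth 1 (1 :: s))).

(** The value 0 on words of the wrong size lets braces vanish by themselves outside their degree. *)
Definition hval x s : A := if size s == hdeg x then @wval (hdeg x) (tagged x) s else 0.

(** The size of the word selects the component, so a whole direct sum becomes one function on
    nonempty words. *)
Definition dval (u : dsum C) s : A :=
  if s is _ :: s' then @wval (size s').+1 (dcomp u (size s')) s else 0.

Lemma dvalP c u v s : dval (c *: u + v) s = c *: dval u s + dval v s.
Proof. by case: s => [|a s]; rewrite ?scaler0 ?addr0. Qed.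

Lemma dval_emb x s : dval (emb x) s = hval x s.
Proof.
case: x => m f; rewrite /hval /hdeg /=; case: s => [//|a s].
rewrite [size _]/= eqSS /dval /=; case: eqP => [sm|sm].
  by subst m; rewrite untagE.
by rewrite untag_dflt //; apply/eqP => /= ms; apply: sm.
Qed.

Lemma pact1 n (t : tpow A n) : pact M 1 t = t.
Proof.
elim: n t => [|n IH] t; first by rewrite /= counit1 scale1r.
move: t; apply: tensor_ext => [||a t]; [|exact: linear_idfun|].
  exact: (@pact_linear _ _ _ _ M n.+1).
rewrite pactE comul1 tliftE ?hact1 ?IH //.
split=> [v|u].
  exact: (linear_comp (tens_linearl _) (hact_linearl M a)).
exact: (linear_comp (tens_linearr _) ((pact_bilinear M n).1 t)).
Qed.

(** X-linearity for a_0 (x) a_{n+1} (x) 1, whose last factor acts as the identity on tensor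
    powers. *)
Lemma cochain_inner n (f : cochain M n) (a : nat -> A) :
  cochain_val f (pure n.+2 a) = a 0%N * wval f (mkseq (fun i => a i.+1) n) * a n.+1.
Proof.
have [_ fX] := cochainP f; have := fX (tens (a 0%N) (tens (a n.+1) 1))
  (pure n.+2 (nth 1 (1 :: mkseq (fun i => a i.+1) n))).
rewrite xactTE xactAE pact1 hact1 ract_pure lact_pure => <-; congr cochain_val.
apply: eq_pure => -[|i] /= ltin; rewrite ?mulr1 // eqSS.
case: eqP => [->|ni]; first by rewrite nth_default ?size_mkseq // mul1r.
by rewrite nth_mkseq //; lia.
Qed.

Lemma dval_inj u v : (forall s, dval u s = dval v s) -> u = v.
Proof.
move=> uv; apply: dsum_ext => m; apply: val_inj; apply/funext.
have [[lu _] [lv _]] := (cochainP (dcomp u m : cochain M m.+1),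
                         cochainP (dcomp v m : cochain M m.+1)).
apply: (tpow_ext lu lv) => a; rewrite !(@cochain_inner m.+1).
by have := uv (mkseq (fun i => a i.+1) m.+1); rewrite /= size_map size_iota => ->.
Qed.

Lemma hval_multilinear x : @multilinear K A A (hval x).
Proof.
case: x => m f u w c a b; rewrite /hval /hdeg !size_cat /=.
case: eqP => [sz|_]; last by rewrite scaler0 addr0.
have [lf _] := cochainP (f : cochain M m.+1); rewrite -lf; congr cochain_val.
(* The leading 1 shifts the varying letter by one position. *)
have nth_uw d j : nth 1 (1 :: u ++ d :: w) j =
    if j == (size u).+1 then d else nth 1 (1 :: u ++ 1 :: w) j.
  case: j => [//|j]; rewrite eqSS /= !nth_cat; case: ltngtP => // [ju|->].
    by rewrite -(subnSK ju).
  by rewrite subnn.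
apply: (@pure_linear _ _ _ _ _ _ _ (size u).+1).
- by move: sz; rewrite /= => <-; lia.
- by rewrite (nth_uw a) (nth_uw b) (nth_uw (_ + _)) eqxx.
- by move=> j /negPf ju; rewrite (nth_uw a) (nth_uw (_ + _)) ju.
by move=> j /negPf ju; rewrite (nth_uw b) (nth_uw (_ + _)) ju.
Qed.

Lemma dval_cochain_emb n (f : cochain M n) s :
  dval (cochain_emb f) s = if (0 < n)%N && (size s == n) then wval f s else 0.
Proof.
case: n f => [|n] f /=; first by case: s.
by rewrite dval_emb.
Qed.

End CochainWords.

(** * Braces of cochains as braces of functions on words *)

Section WordBrace.
Variables (K : fieldType) (H : algType K) (D : bialgebra H) (A : algType K).
Variable M : module_algebra D A.
Local Notation C := (CH M).
Implicit Types (x : helt C) (xs : seq (helt C)) (s : seq A) (g : nat -> helt C).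

Definition to_opr x : opr A := (sdeg x, hval x).

Lemma degs_to_opr xs : degs (fun X : opr A => X.1) (map to_opr xs) = degs (@sdeg _ _) xs.
Proof. by rewrite /degs big_map; apply: eq_bigr. Qed.

Lemma hval_idc s : hval (idc M) s = if s is [:: a] then a else 0.
Proof.
case: s => [//|a [|b s] //].
rewrite -[LHS]/(cochain_val (mu M 1) (pure 3 (nth 1 [:: 1; a]))) muE.
by rewrite !big_ord_recl big_ord0 /= mul1r !mulr1.
Qed.

(** The word that f receives in gamma(f; g): consecutive blocks of [s] replaced by their values. *)
Definition slots g n s : seq A :=
  mkseq (fun i => hval (g i) (take (hdeg (g i)) (drop (offset g i) s))) n.

Lemma offset0 g : offset g 0 = 0%N.
Proof. exact: big_ord0. Qed.

Lemma slotsS g n s :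
  slots g n.+1 s = hval (g 0%N) (take (hdeg (g 0%N)) s)
    :: slots (fun i => g i.+1) n (drop (hdeg (g 0%N)) s).
Proof.
rewrite /slots /mkseq -[iota 0 n.+1]/(0%N :: iota 1 n) map_cons.
rewrite offset0 drop0; congr (_ :: _).
rewrite (iotaDl 1 0) -map_comp; apply: eq_map => i /=.
by rewrite add1n offsetS drop_drop [(hdeg _ + _)%N]addnC.
Qed.

Definition mask_sign (m : seq bool) g : nat :=
  (\sum_(i < size m | nth false m i) sdeg (g i) * offset g i)%N.

Lemma fill_degs (m : seq bool) xs : count id m = size xs ->
  (\sum_(i < size m | nth false m i) sdeg (fill m xs i) = degs (@sdeg _ _) xs)%N.
Proof.
elim: m xs => [|b m IH] xs.
  by case: xs => // _; rewrite big_ord0 degs_nil.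
rewrite [size _]/= big_mkcond big_ord_recl /= -big_mkcond.
case: b xs => [[//|x xs]|xs] /= => [[mxs]|mxs].
  by rewrite degs_cons -(IH _ mxs).
by rewrite add0n -(IH _ mxs).
Qed.

(** A new first slot puts its [hdeg] inputs in front of every later substituted argument. *)
Lemma mask_signS b (m : seq bool) xs xs' : count id m = size xs' ->
  (forall i, fill (b :: m) xs i.+1 = fill m xs' i) ->
  mask_sign (b :: m) (fill (b :: m) xs) =
  (hdeg (fill (b :: m) xs 0) * degs (@sdeg _ _) xs' + mask_sign m (fill m xs'))%N.
Proof.
move=> mxs' fxs; rewrite /mask_sign [size _]/= big_mkcond big_ord_recl.
rewrite offset0 muln0 if_same Monoid.mul1m -(fill_degs mxs') big_distrr -big_split.
rewrite -big_mkcond; apply: eq_bigr => i _.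
rewrite -[nat_of_ord (lift _ _)]/(i.+1) fxs offsetS (funext fxs).
by rewrite mulnDr mulnC.
Qed.

Local Arguments fill : simpl never.

(** A [false] entry is a slot filled with Id, which copies one letter; so a mask term is a term of
    the brace of cochains, with the same sign. *)
Lemma mask_brace_fill (V : lmodType K) (F : seq A -> V) (m : seq bool) xs s :
  count id m = size xs ->
  mask_brace F m (map to_opr xs) s =
  if size s == offset (fill m xs) (size m) then
    (-1) ^+ mask_sign m (fill m xs) *: F (slots (fill m xs) (size m) s)
  else 0.
Proof.
elim: m F xs s => [|b m IH] F xs s.
  case: xs => // _; rewrite offset0; case: s => [|a s] //=.
  by rewrite /mask_sign big_ord0 expr0 scale1r.
case: b xs => [[//|x xs]|xs] /= => [[mxs]|mxs].
  rewrite offsetS slotsS (mask_signS mxs) // IH //.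
  rewrite -[fill (true :: m) (x :: xs) 0]/x.
  rewrite -[fun p => fill (true :: m) (x :: xs) p.+1]/(fill m xs).
  rewrite size_drop degs_to_opr exprD -scalerA; case: ltnP => sx.
    rewrite -(eqn_add2l (hdeg x)) subnKC //; case: eqP => // _.
    by rewrite scaler0.
  by rewrite ltn_eqF // /hdeg; move: sx; rewrite /sdeg; lia.
case: s => [|a s]; rewrite offsetS //.
rewrite slotsS (mask_signS mxs) // IH //.
rewrite -[fill (false :: m) xs 0]/(idc M).
rewrite -[fun p => fill (false :: m) xs p.+1]/(fill m xs).
rewrite /= eqSS degs_to_opr exprD -scalerA mul1n; case: eqP => // _.
  by rewrite take0 drop0 hval_idc.
by rewrite scaler0.
Qed.

Lemma offset_recr g n : offset g n.+1 = (offset g n + hdeg (g n))%N.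
Proof. exact: big_ord_recr. Qed.

Lemma leq_offset g i n : (i <= n)%N -> (offset g i <= offset g n)%N.
Proof.
elim: n => [|n IH]; first by rewrite leqn0 => /eqP->.
rewrite leq_eqVlt => /predU1P[-> //|/IH in_]; rewrite offset_recr.
exact: leq_trans in_ (leq_addr _ _).
Qed.

(** The units with which [gamma] surrounds each block are those with which [wval] surrounds a
    word. *)
Lemma dval_gamma x g s :
  dval (cochain_emb (gamma (tagged x : cochain M (hdeg x)) g)) s =
  if size s == offset g (hdeg x) then hval x (slots g (hdeg x) s) else 0.
Proof.
have g0 : (0 < offset g (hdeg x))%N by rewrite /hdeg offsetS.
rewrite dval_cochain_emb g0 andTb; case: eqP => // sg.
rewrite /hval size_mkseq eqxx /wval gammaE; congr cochain_val.
apply: eq_pure => -[//|i] ix; rewrite eqE /= nth_default ?sg //.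
case: ltnP => xi; last by rewrite nth_default // size_mkseq.
have le_off := leq_offset g xi; rewrite offset_recr in le_off.
rewrite nth_mkseq // /gamma_slot /hval size_takel ?eqxx; last first.
  by rewrite size_drop sg leq_subRL ?(leq_trans _ le_off) ?leq_addr.
congr cochain_val; apply: eq_pure => -[//|j] jx.
rewrite /= -/(hdeg _); case: ltnP => jl; last first.
  rewrite nth_default // size_takel ?size_drop ?sg //.
  by rewrite leq_subRL ?(leq_trans _ le_off) ?leq_addr.
by rewrite addnS /= nth_take // nth_drop.
Qed.

Lemma dval_hbrace x xs s : dval (hbrace x xs) s = fbr (hval x) (map to_opr xs) s.
Proof.
have ldv : linear (fun u : dsum C => dval u s) by move=> c u v; exact: dvalP.
pose t (m : seq bool) := mask_brace (hval x) m (map to_opr xs) s.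
have t0 m : count id m != size xs -> t m = 0.
  rewrite /t; elim: m xs s (hval x) {t ldv} => [|b m IH] xs' s' F /=.
    by case: xs' => //= _; case: s'.
  case: b xs' => [[|x' xs']|xs'] //= mxs.
    by case: ifP => // _; rewrite IH ?scaler0.
  by case: s' => // a s'; rewrite IH ?scaler0.
transitivity (\sum_(m : (hdeg x).-tuple bool) t m).
  rewrite /hbrace big_mkcond (linear_fun_sum _ _ ldv).
  apply: eq_bigr => m _; case: eqP => [mxs|/eqP/t0-> //].
    rewrite /t mask_brace_fill // size_tuple.
    rewrite (linear_funZ _ _ ldv) dval_gamma /mask_sign size_tuple.
    by case: eqP => // _; rewrite scaler0.
  exact: (linear_fun0 ldv).
case: (size s =P (hdeg x + degs (fun X : opr A => X.1) (map to_opr xs))%N) => [sx|sx].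
  by rewrite -(fbr_masks _ sx).
rewrite (eq_fbr (G := fun=> 0)) ?fbr0 => [|z zs]; last first.
  by rewrite /hval; case: eqP => // zx; case: sx; rewrite -zx zs.
rewrite big1 // => m _; rewrite /t; have [mxs|/t0//] := eqVneq (count id m) (size xs).
rewrite mask_brace_fill // size_tuple; case: eqP => // so; case: sx.
rewrite so degs_to_opr -(fill_degs mxs) size_tuple /offset.
under eq_bigr => i _ do rewrite /hdeg -add1n.
rewrite big_split sum1_card card_ord [in RHS]big_mkcond; congr (_ + _)%N.
by apply: eq_bigr => i _; rewrite /fill; case: ifP.
Qed.

End WordBrace.

(** * The brace relation for cochains *)

Section HopfBrace.
Variables (K : fieldType) (H : algType K) (D : bialgebra H) (A : algType K).
Variable M : module_algebra D A.
Local Notation C := (CH M).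
Implicit Types (x y : helt C) (xs ys : seq (helt C)) (s : seq A).

Let br := hopf_brace M.

Lemma hval_linear m s : linear (fun f : C m => hval (Tagged C f) s : A).
Proof.
by move=> c f g; rewrite -!dval_emb (@emb_linear K C) dvalP.
Qed.

Lemma hbrace_linearl xs : tag_linear (fun x => hbrace x xs).
Proof.
move=> m c f g; apply: dval_inj => s; rewrite dvalP !dval_hbrace -fbrP.
by apply: eq_fbr => z _; rewrite hval_linear.
Qed.

Lemma hbrace_linearr x : slot_linear (hbrace x).
Proof.
move=> xs ys m c f g; apply: dval_inj => s; rewrite dvalP !dval_hbrace !map_cat /=.
apply: fbr_op_linear; first exact: hval_multilinear.
by move=> t; rewrite hval_linear.
Qed.

Lemma dval_brace x xs s :
  dval (br (emb x) (map (@emb _ C) xs)) s = fbr (hval x) (map (@to_opr _ _ _ _ M) xs) s.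
Proof.
by rewrite /br /hopf_brace (mlextend_emb hbrace_linearl hbrace_linearr) dval_hbrace.
Qed.

Lemma emb_of_dval n (u : dsum C) : (forall s, size s != n.+1 -> dval u s = 0) ->
  emb (Tagged C (dcomp u n)) = u.
Proof.
move=> un; apply: dval_inj => s; rewrite dval_emb /hval /hdeg /=.
case: eqP => [sn|/eqP/un//]; case: s sn => [//|a s] [sn].
by rewrite /dval -sn.
Qed.

(** The brace as a homogeneous element with a named degree; only in this form can it be read as a
    function by [to_opr]. *)
Definition hop x xs : helt C :=
  Tagged C (dcomp (br (emb x) (map (@emb _ C) xs)) (sdeg x + degs (@sdeg _ C) xs)).

Lemma emb_hop x xs : emb (hop x xs) = br (emb x) (map (@emb _ C) xs).
Proof.
apply: emb_of_dval => s sn; rewrite dval_brace (eq_fbr (G := fun=> 0)) ?fbr0 // => z zs.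
rewrite /hval; case: eqP => // zx; move: sn.
by rewrite -zs zx degs_to_opr eqxx.
Qed.

Lemma to_opr_hop x xs :
  to_opr (hop x xs) = fop (to_opr x) (map (@to_opr _ _ _ _ M) xs).
Proof.
congr (_, _); first by rewrite /= degs_to_opr.
by apply/funext => s; rewrite -dval_emb emb_hop dval_brace.
Qed.

Lemma hopf_brace_algebra : is_brace_algebra br.
Proof.
have lin us : linear (fun u => br u us) by apply/mlextend_linearl/hbrace_linearl.
split.
- apply: eq_linear_dsum; [exact: lin|exact: linear_idfun|move=> x].
  by apply: dval_inj => s; rewrite (dval_brace x [::]) dval_emb.
- by move=> us a u v; apply: lin.
- by move=> w us us' a u v; apply/mlextend_linearr/hbrace_linearr.
- move=> x xs; exists (hop x xs); last exact: esym (emb_hop x xs).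
  rewrite /hdeg /= -/(sdeg x); elim: xs => [|z xs IH].
    by rewrite big_nil degs_nil subn0 !addn0.
  rewrite big_cons degs_cons /= /hdeg -/(sdeg z).
  (* The degree of a brace is a truncated subtraction; it is harmless because every argument has
     degree at least 1. *)
  have : (size xs <= \sum_(z <- xs) hdeg z)%N.
    elim: xs {IH} => [|t xs IH] //; rewrite big_cons /hdeg addSn ltnS.
    exact: leq_trans IH (leq_addl _ _).
  by move: IH; rewrite /sdeg /hdeg; lia.
move=> x xs ys; rewrite (sum_insertions br (br (emb x))).
apply: dval_inj => s.
have ldv : linear (fun u : dsum C => dval u s) by move=> c u v; exact: dvalP.
rewrite (isum_linear _ _ _ _ _ _ ldv) -emb_hop dval_brace.
rewrite -[in RHS](map_id xs) -[in RHS](map_id ys) (isum_map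
  (degS := @sdeg _ C) (j := id) (pr := hop) (h' := @emb _ C)) //
  => [|z zs]; last by rewrite emb_hop map_id.
have -> : hval (hop x xs) = fbr (hval x) (map (@to_opr _ _ _ _ M) xs).
  by have [_] := to_opr_hop x xs.
rewrite fbr_fbr; last exact: hval_multilinear.
rewrite (isum_map (degS := @sdeg _ C) (j := id) (pr := hop)
  (h' := @to_opr _ _ _ _ M)) // => [|z zs]; last by rewrite to_opr_hop.
by apply: eq_isum => l; rewrite dval_brace.
Qed.

End HopfBrace.

(** * The multiplication of cochains *)

Section Multiplication.
Variables (K : fieldType) (H : algType K) (D : bialgebra H) (A : algType K).
Variable M : module_algebra D A.

Lemma hval_pic (s : seq A) : hval (pic M) s = if s is [:: a; b] then a * b else 0.
Proof.
case: s => [//|a [|b [|c s]] //].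
rewrite -[LHS]/(cochain_val (mu M 2) (pure 4 (nth 1 [:: 1; a; b]))) muE.
by rewrite !big_ord_recl big_ord0 /= mul1r !mulr1.
Qed.

(** Associativity of A: on three letters the value is (ab)c - a(bc), with the sign of the one letter
    in front of the second slot. *)
Lemma pic_square : hopf_brace M (emb (pic M)) [:: emb (pic M)] = 0.
Proof.
apply: dval_inj => s; rewrite (dval_brace (pic M) [:: pic M]).
have -> : dval (0 : dsum (CH M)) s = 0 by case: s.
have [s3|s3] := eqVneq (size s) 3%N; last first.
  rewrite (eq_fbr (G := fun=> 0)) ?fbr0 // => z zs.
  rewrite hval_pic; case: z zs => [//|a [|b [|c z]] //] zs.
  by move: s3; rewrite -zs degs_cons degs_nil.
case: s s3 => [//|a [|b [|c [|? ?]]] //] _.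
rewrite !fbr_letter /= !degs_cons !degs_nil /= !hval_pic !addr0 !addn0.
by rewrite !(muln0, expr0, expr1, scale1r, scaler0, oppr0, add0r, scaleN1r) mulrA addNr.
Qed.

Lemma pic_arity (xs : seq (helt (CH M))) : (2 < size xs)%N ->
  hopf_brace M (emb (pic M)) (map (@emb _ (CH M)) xs) = 0.
Proof.
move=> xs2; rewrite /hopf_brace mlextend_emb; last exact: hbrace_linearr.
  rewrite /hbrace big_pred0 // => m; apply/negbTE; rewrite neq_ltn.
  by rewrite (leq_ltn_trans (count_size _ _)) // size_tuple.
exact: hbrace_linearl.
Qed.

End Multiplication.

Theorem corollary5p3 (K : fieldType) (H : algType K) (D : bialgebra H)
    (A : algType K) (M : module_algebra D A) :
  is_homotopy_G_algebra (hopf_brace M) (hopf_diff M) (hopf_cup M).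
Proof.
apply: brace_multiplication_homotopy_G.
- exact: hopf_brace_algebra.
- by [].
- exact: pic_square.
exact: pic_arity.
Qed.
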